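(* Let $V\subset H^0(\mathbb{P}^2,\mathcal{O}_{\mathbb{P}^2}(3))$ be a pencil of plane cubics over $\mathbb{C}$ satisfying conditions (C1), (C2) and (C3), and let $p\in\mathbb{P}^2$ be its base point. Then for any smooth member $C\in|V|$, if the origin of the group law on $C$ is fixed in a flex of $C$, the point $p$ is a $9$-torsion point of $C$ which is not $3$-torsion.
   Context: We work over $\mathbb{C}$. A pencil of plane cubics is a $2$-dimensional linear subspace $V\subset H^0(\mathbb{P}^2,\mathcal{O}_{\mathbb{P}^2}(3))$, with associated linear system $|V|=\mathbb{P}(V)$; its members are the cubic curves defined by nonzero elements of $V$, and its base points are the points common to all members. The conditions are: (C1) there is only one base point (set-theoretically); (C2) the general member is smooth; (C3) all members are irreducible (in particular reduced). A point $q\in C$ is $n$-torsion if $nq=0$ in the group law on $C$ with the chosen origin. *)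

(* Defs.v *)
From HB Require Import structures.
From mathcomp Require Import all_boot all_order all_algebra.
From mathcomp Require Import boolp classical_sets reals.
From mathcomp Require Import complex.
From mathcomp Require Import mpoly.

Set Implicit Arguments.
Unset Strict Implicit.
Unset Printing Implicit Defensive.

Import GRing.Theory.
Local Open Scope ring_scope.

Section PlaneCurves.
Variable K : fieldType.

(* P^2 is the set of lines through the origin of K^3. *)
Record point := Point { point_space :> {vspace 'rV[K]_3};
                        point_dim : \dim point_space == 1%N }.
HB.instance Definition _ := [isSub for point_space].
HB.instance Definition _ := [Choice of point by <:].

Record line := Line { line_space :> {vspace 'rV[K]_3};
                      line_dim : \dim line_space == 2%N }.

(* H^0(P^2, O(3)), a vectType of dimension 10. *)
Definition cubic := dhomog 3 K 3.

Implicit Types (F : cubic) (P Q S O : point) (L : line).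

Definition on_curve F P : Prop :=
  forall v, v \in (P : {vspace _}) -> F.@[v 0] = 0.

Definition smooth F : Prop :=
  forall P, on_curve F P ->
  exists2 v, v \in (P : {vspace _}) & exists i, (F^`M(i)).@[v 0] != 0.

Definition irreducible_cubic F : Prop :=
  [/\ (F : {mpoly K[3]}) != 0, (F : {mpoly K[3]}) \isn't a GRing.unit &
      forall g h : {mpoly K[3]}, (F : {mpoly K[3]}) = g * h ->
        g \is a GRing.unit \/ h \is a GRing.unit].

(* The polynomial F(u + t v) in the variable t. *)
Definition restr F (u v : 'rV[K]_3) : {poly K} :=
  mmap polyC (fun i => (u 0 i)%:P + v 0 i *: 'X) F.

(* Intersection multiplicity at P of the curve F = 0 with a line L through P:
   the order at t = 0 of F(u + t v), where P = <u> and L = <u, v>; it does not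
   depend on u and v.  As mup vanishes on the zero polynomial, this is
   meaningful only if L is not a component of the curve, which is always the
   case for smooth or irreducible cubics over an algebraically closed field. *)
Definition int_mult F L P : nat :=
  mup 0 (restr F (vpick P) (vpick (L :\: P)%VS)).

(* The intersection cycle of L with the curve F = 0 is P + Q + S. *)
Definition line_section F L P Q S : Prop :=
  [/\ (P <= L)%VS, (Q <= L)%VS, (S <= L)%VS &
      forall X : point, (X <= L)%VS -> int_mult F L X = count_mem X [:: P; Q; S]].

Definition flex F O : Prop :=
  on_curve F O /\ exists L, (O <= L)%VS /\ (3 <= int_mult F L O)%N.

(* Chord-tangent construction: the third point of intersection of the curve
   with the line through P and Q (its tangent at P if P = Q).  For P and Q on
   a smooth cubic over an algebraically closed field it exists and is unique. *)
Definition third F P Q : point :=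
  xget P [set S | exists L, line_section F L P Q S]%classic.

(* The group law with origin O, and the multiples of a point. *)
Definition cadd F O P Q : point := third F O (third F P Q).

Definition cmul F O (n : nat) P : point := iter n (cadd F O P) O.

Definition torsion F O (n : nat) P : Prop := on_curve F P /\ cmul F O n P = O.

Section LinearSystem.
Variable V : {vspace cubic}.

Definition member F : Prop := F \in V /\ F != 0.

Definition base_point P : Prop := forall F, member F -> on_curve F P.

(* A property of members invariant under scaling holds for the general member
   if it holds on the complement in P(V) of some hypersurface h = 0, where h is
   a nonzero form in the coordinates on V. *)
Definition general_member (A : cubic -> Prop) : Prop :=
  exists (d : nat) (h : {mpoly K[\dim V]}),
    [/\ h \is d.-homog, h != 0 &
        forall F, member F ->
          h.@[fun i => coord (vbasis V) i F] != 0 -> A F].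

Definition single_base_point : Prop := exists! P, base_point P.
Definition general_member_smooth : Prop := general_member smooth.
Definition members_irreducible : Prop := forall F, member F -> irreducible_cubic F.

End LinearSystem.
End PlaneCurves.

(* Main.v *)
Require Import Defs.
From HB Require Import structures.
From mathcomp Require Import all_boot all_order all_algebra.
From mathcomp Require Import ring zify boolp.
From mathcomp Require Import reals complex mpoly.

(** Let F be the given smooth member and G a second generator of the pencil.
    The two curves meet only at p, so their contact at p has order nine
    ([contact_nine]).  Both halves of the statement follow from this by
    restricting forms to lines.

    The link is the case of Noether's theorem in which one divides by a line
    ([noether_line]): if a form A meets F at least in P + Q + S + D, where
    P + Q + S is the section of F by the line l = 0, then A = l A' + F H with A'
    meeting F at least in D.  Indeed the contact of A with F at P, Q, S makes
    the restriction of A to the line divisible by that of F, and after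
    subtraction of a multiple of F the form A vanishes on the line.

    If 3p = o, the uniqueness of the third point on a chord makes p a flex
    ([three_torsion_flex]).  Dividing G by the flex tangent at p leaves
    G = l A + k F with k constant, so G - k F is a member of the pencil which
    contains a line, and this contradicts irreducibility.

    For 9p = o, start from the cubic G, which meets F in 9p, and add the copies
    of p one at a time.  Given a cubic meeting F at least in P + Q + D, multiply
    it by the line through o and the third point R of the chord PQ, which meets F
    in o + R + (P + Q), and divide modulo F by the chord itself: the result is a
    cubic meeting F at least in o + (P + Q) + D ([chord_step]).  After eight
    steps there is a cubic meeting F at least in 8 o and the point 9p.  Dividing
    it twice by the tangent at the flex o leaves a line meeting F twice at o and
    at 9p.  This line is the tangent at o, whose only point on F is o, hence
    9p = o ([nine_torsion]).

    Contact orders with F are read on polynomial arcs that follow the branch of F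
    up to a fixed order.  The order nine at p comes from the norm of G along the
    lines through a point c off F, that is the product of the values of G at the
    three points of F on such a line.  On the pencil of lines through c it is a
    binary form of degree nine which vanishes only at the line through p, and
    near this line it is the value of G on the branch at p times a function
    without zero. *)

Set Implicit Arguments.
Unset Strict Implicit.
Unset Printing Implicit Defensive.

Import GRing.Theory.
Local Open Scope ring_scope.

(** * Polynomials in three variables and their values *)

Section Forms.
Variable K : closedFieldType.
Implicit Types (A B : {mpoly K[3]}) (u v w : 'rV[K]_3) (p q : {poly K}).

Lemma mpoly_alg_ind (P : {mpoly K[3]} -> Prop) :
  (forall c, P c%:MP) -> (forall i, P 'X_i) ->
  (forall A B, P A -> P B -> P (A + B)) ->
  (forall A B, P A -> P B -> P (A * B)) -> forall A, P A.
Proof.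
move=> PC PX PD PM; elim/mpolyind => [|c m A _ _ PA]; first by rewrite -mpolyC0.
apply: PD => //; rewrite -mul_mpolyC; apply: (PM) => //.
rewrite mpolyXE_id; apply: (big_ind P) => [|B C|i _]; first by rewrite -mpolyC1.
  by move=> PB PC'; apply: (PM).
by elim: (m i) => [|k IH]; rewrite ?expr0 -?mpolyC1 ?exprS //; apply: (PM).
Qed.

Lemma mmap_taylor (S : comNzRingType) (f : {rmorphism K -> S})
    (x y : 'I_3 -> S) (h : S) A :
  exists E, mmap f (fun i => x i + h * y i) A =
    mmap f x A + h * (\sum_i mmap f x A^`M(i) * y i) + h ^+ 2 * E.
Proof.
elim/mpoly_alg_ind: A => [c|j|A B [E1 e1] [E2 e2]|A B [E1 e1] [E2 e2]].
- exists 0; rewrite !mmapC big1 ?mulr0 ?addr0 // => i _.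
  by rewrite mderivC mmap0 mul0r.
- exists 0; rewrite !mmapX !mmap1U mulr0 addr0 (bigD1 j) //=.
  rewrite big1 ?addr0 => [|i neij].
    have -> : ('X_j : {mpoly K[3]})^`M(j) = 1%:MP.
      rewrite mderivX mnm1E eqxx scale1r mpolyC1 -mpolyX0; congr 'X_[_].
      by apply/mnmP => i; rewrite mnmBE subnn mnm0E.
    by rewrite mmapC /= rmorph1 mul1r.
  by rewrite mderivX mmapZ mnm1E eq_sym (negPf neij) rmorph0 !mul0r.
- exists (E1 + E2); rewrite !mmapD e1 e2.
  have -> : \sum_i mmap f x (A + B)^`M(i) * y i =
      \sum_i mmap f x A^`M(i) * y i + \sum_i mmap f x B^`M(i) * y i.
    by rewrite -big_split; apply: eq_bigr => i _; rewrite mderivD mmapD mulrDl.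
  ring.
- rewrite !rmorphM /= e1 e2.
  set a := mmap f x A; set b := mmap f x B.
  set da := \sum_i _; set db := \sum_i _.
  have -> : \sum_i mmap f x (A * B)^`M(i) * y i = da * b + a * db.
    rewrite mulr_suml mulr_sumr -big_split; apply: eq_bigr => i _ /=.
    by rewrite mderivM mmapD !rmorphM /= mulrDl mulrAC mulrA.
  exists (a * E2 + E1 * b + da * db + h * (da * E2 + db * E1) + h ^+ 2 * E1 * E2).
  ring.
Qed.


Lemma mmap_comp (S T : comNzRingType) (f : {rmorphism K -> S})
    (g : {rmorphism K -> T}) (h : {rmorphism S -> T}) (x : 'I_3 -> S) A :
  (forall c, h (f c) = g c) -> h (mmap f x A) = mmap g (fun i => h (x i)) A.
Proof.
move=> hfg; elim/mpoly_alg_ind: A => [c|j|A B eA eB|A B eA eB].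
- by rewrite !mmapC hfg.
- by rewrite !mmapX !mmap1U.
- by rewrite !mmapD rmorphD /= eA eB.
- by rewrite !rmorphM /= eA eB.
Qed.

Lemma mmap_ext (S : comNzRingType) (f : {rmorphism K -> S}) (x y : 'I_3 -> S) A :
  x =1 y -> mmap f x A = mmap f y A.
Proof. by move=> /funext ->. Qed.

Lemma horner_mmap (x : 'I_3 -> {poly K}) A t :
  (mmap polyC x A).[t] = A.@[fun i => (x i).[t]].
Proof.
by apply: (@mmap_comp _ _ polyC idfun (horner_eval t) x A) => c; exact: hornerC.
Qed.

Lemma poly_fun_eq0 p (s : seq K) : (forall t, t \notin s -> p.[t] = 0) -> p = 0.
Proof.
move=> p0; suff : p * \prod_(z <- s) ('X - z%:P) == 0.
  rewrite mulf_eq0 => /orP[/eqP //|].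
  by rewrite prodf_seq_eq0 => /hasP[z _]; rewrite polyXsubC_eq0.
apply/contraT => /closed_nonrootP[t]; rewrite rootM root_prod_XsubC.
by have [ts|/p0 e] := boolP (t \in s); rewrite ?ts ?orbT // rootE e eqxx.
Qed.

Lemma poly_fun_inj p q (s : seq K) :
  (forall t, t \notin s -> p.[t] = q.[t]) -> p = q.
Proof.
move=> e; apply/eqP; rewrite -subr_eq0; apply/eqP/(@poly_fun_eq0 _ s) => t ts.
by rewrite hornerE hornerN e // subrr.
Qed.

Lemma digits_inj b (m n : 'X_{1..3}) :
  (forall i, m i < b)%N -> (forall i, n i < b)%N ->
  (\sum_(i < 3) b ^ i * m i = \sum_(i < 3) b ^ i * n i)%N -> m = n.
Proof.
move=> mb nb; rewrite !big_ord_recl !big_ord0 /= /bump /= !addn0 !expn0 !mul1n.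
move: (mb ord0) (mb (lift ord0 ord0)) (nb ord0) (nb (lift ord0 ord0)).
move=> m0 m1 n0 n1.
rewrite expn1 -mulnn -!mulnA -!mulnDr => /eqP.
have b0 : (0 < b)%N by apply: leq_ltn_trans m0.
have digit x y x' y' : (x < b)%N -> (x' < b)%N ->
    (x + b * y = x' + b * y')%N -> x = x' /\ y = y'.
  move=> xb x'b e; have exx : x = x'.
    have := congr1 (modn^~ b) e.
    by rewrite ![(_ + b * _)%N]addnC ![(b * _)%N]mulnC !modnMDl !modn_small.
  by split=> //; move: e; rewrite exx => /addnI/eqP; rewrite eqn_pmul2l // => /eqP.
move=> /eqP /digit[] // e0 /digit[] // e1 e2.
apply/mnmP => i; case: i => -[|[|[|//]]] lti.
- by rewrite (_ : Ordinal lti = ord0) //; apply: val_inj.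
- by rewrite (_ : Ordinal lti = lift ord0 ord0) //; apply: val_inj.
- by rewrite (_ : Ordinal lti = lift ord0 (lift ord0 ord0)) //; apply: val_inj.
Qed.

(** Kronecker's substitution x_i := t^(b^i), with b larger than all exponents,
    sends distinct monomials to distinct powers of t and so reduces the claim to
    polynomials in one variable. *)
Lemma mpoly_fun_eq0 A : (forall v, A.@[v 0] = 0) -> A = 0.
Proof.
move=> A0; pose b := msize A; pose kr (m : 'X_{1..3}) := (\sum_(i < 3) b ^ i * m i)%N.
pose x (i : 'I_3) : {poly K} := 'X ^+ (b ^ i).
have small m : m \in msupp A -> forall i, (m i < b)%N.
  move=> mA i; apply: leq_ltn_trans (msize_mdeg_lt mA).
  by rewrite mdegE (bigD1 i) //= leq_addr.
have xE m : mmap1 x m = 'X ^+ kr m.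
  rewrite /mmap1 /kr expr_sum; apply: eq_bigr => i _.
  by rewrite /x -exprM.
have Ax : mmap polyC x A = 0.
  apply: (@poly_fun_eq0 _ [::]) => t _; rewrite horner_mmap.
  rewrite -[RHS](A0 (\row_i (x i).[t])).
  by apply: mmap_ext => i; rewrite mxE.
apply/mpolyP => m; rewrite mcoeff0.
have [mA|] := boolP (m \in msupp A); last by move/memN_msupp_eq0.
have := congr1 (fun p : {poly K} => p`_(kr m)) Ax.
rewrite coef0 /mmap coef_sum (bigD1_seq m) ?msupp_uniq //= big_seq_cond big1.
  by rewrite addr0 xE mul_polyC coefZ coefXn eqxx mulr1.
move=> n /andP[nA nm]; rewrite xE mul_polyC coefZ coefXn.
case: eqP => [e|]; last by rewrite mulr0.
by rewrite (digits_inj (small _ mA) (small _ nA) e) eqxx in nm.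
Qed.

End Forms.

(** * Restriction of a form to a line *)

Section Lines.
Variable K : closedFieldType.
Implicit Types (A B : {mpoly K[3]}) (a b u v w l : 'rV[K]_3) (p q : {poly K}).

Lemma mmap_homog (S : comNzRingType) (f : {rmorphism K -> S}) d s
    (x : 'I_3 -> S) A :
  A \is d.-homog -> mmap f (fun i => s * x i) A = s ^+ d * mmap f x A.
Proof.
move=> /dhomogP hA; rewrite /mmap mulr_sumr !big_seq; apply: eq_bigr => m mA.
have dE : d = (\sum_(i < 3) m i)%N by rewrite -mdegE -(hA m mA).
rewrite mulrCA; congr (_ * _); rewrite dE expr_sum -big_split.
by apply: eq_bigr => i _; rewrite exprMn.
Qed.

Lemma meval_homog d s v A :
  A \is d.-homog -> A.@[(s *: v) 0] = s ^+ d * A.@[v 0].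
Proof.
move=> hA; rewrite -(@mmap_homog _ idfun d s _ _ hA).
by apply: mmap_ext => i; rewrite mxE.
Qed.

(** For cubics this is convertible to [restr]. *)
Definition form_restr A u v : {poly K} :=
  mmap polyC (fun i => (u 0 i)%:P + v 0 i *: 'X) A.

Lemma horner_form_restr A u v t : (form_restr A u v).[t] = A.@[(u + t *: v) 0].
Proof.
rewrite horner_mmap; apply: mmap_ext => i.
by rewrite !hornerE !mxE mulrC.
Qed.

(** A polynomial p with p(t) = t^d q(1/t) is the reversal of q in degree d; the
    relation is required only for t <> 0, so that it can be checked by scaling
    homogeneous forms. *)
Lemma reverse_coef d p q :
  (forall t, t != 0 -> p.[t] = t ^+ d * q.[t^-1]) ->
  forall i, p`_i = if (i <= d)%N then q`_(d - i) else 0.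
Proof.
move=> pq; pose s := (size q + d).+1.
have ltqs : (size q <= s)%N by rewrite /s leqW // leq_addr.
pose r : {poly K} := \poly_(k < s.+1) q`_(s - k).
have e : 'X ^+ s * p = 'X ^+ d * r.
  apply: (@poly_fun_inj _ _ _ [:: 0]) => t; rewrite inE => t0.
  rewrite !hornerE pq // mulrCA; congr (_ * _).
  rewrite (@horner_coef_wide _ s.+1 q) ?leqW ?leq_addr // /r horner_poly mulr_sumr.
  rewrite (reindex_inj rev_ord_inj); apply: eq_bigr => i _ /=.
  rewrite subSS mulrCA; congr (_ * _); rewrite exprVn -expfB_cond ?(negPf t0) //.
    by rewrite subKn // -ltnS.
  by rewrite add0n leq_subr.
move=> i; have := congr1 (fun z : {poly K} => z`_(s + i)) e.
rewrite !coefXnM -ltn_subRL subnn ltn0 addKn => ->.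
have lds : (d <= s + i)%N by rewrite (leq_trans _ (leq_addr _ _)) // /s leqW // leq_addl.
rewrite ltnNge lds /= coef_poly.
have [lid|lid] := leqP i d.
  have e2 : (s + i - d = s - (d - i))%N by rewrite subnBA.
  by rewrite e2 ltnS leq_subr subKn // (leq_trans (leq_subr _ _)) // /s leqW // leq_addl.
by rewrite ltnNge -(subnK (ltnW lid)) addnA addnK -addn1 leq_add2l subn_gt0 lid.
Qed.

Lemma form_restr_rev d A u v t : A \is d.-homog -> t != 0 ->
  (form_restr A u v).[t] = t ^+ d * (form_restr A v u).[t^-1].
Proof.
move=> hA t0; rewrite !horner_form_restr -(meval_homog _ _ hA); congr (_.@[_ 0]).
by rewrite scalerDr scalerA mulfV // scale1r addrC.
Qed.

Lemma coef0_form_restr A u v : (form_restr A u v)`_0 = A.@[u 0].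
Proof. by rewrite -horner_coef0 horner_form_restr scale0r addr0. Qed.

Lemma lead_form_restr d A u v : A \is d.-homog -> (form_restr A u v)`_d = A.@[v 0].
Proof.
move=> hA; rewrite (reverse_coef (fun t => form_restr_rev u v hA)) leqnn subnn.
exact: coef0_form_restr.
Qed.

Lemma size_form_restr d A u v : A \is d.-homog -> (size (form_restr A u v) <= d.+1)%N.
Proof.
move=> hA; apply/leq_sizeP => j dj.
by rewrite (reverse_coef (fun t => form_restr_rev u v hA)) leqNgt dj.
Qed.

(** On the plane spanned by a and b a form of degree d is a binary form, with the
    same coefficients as its restriction to the affine line a + t b. *)
Lemma binary_form d A a b p q : A \is d.-homog -> p != 0 ->
  mmap polyC (fun i => p * (a 0 i)%:P + q * (b 0 i)%:P) A =
  \sum_(j < d.+1) (form_restr A a b)`_j *: (p ^+ (d - j) * q ^+ j).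
Proof.
move=> hA p0; have [s ps] := closed_field_poly_normal p.
apply: (@poly_fun_inj _ _ _ s) => t ts.
have pt_neq0 : p.[t] != 0.
  by rewrite -rootE ps rootZ ?lead_coef_eq0 // root_prod_XsubC.
rewrite horner_mmap horner_sum.
transitivity (A.@[(p.[t] *: (a + (q.[t] / p.[t]) *: b)) 0]).
  apply: mmap_ext => i; rewrite !hornerE !mxE mulrDr; congr (_ + _).
  by rewrite mulrA [p.[t] * _]mulrC divfK.
rewrite (meval_homog _ _ hA) -horner_form_restr.
rewrite (horner_coef_wide _ (size_form_restr a b hA)) mulr_sumr.
apply: eq_bigr => i _; rewrite hornerZ hornerM !horner_exp mulrCA; congr (_ * _).
rewrite expr_div_n mulrCA mulrC; congr (_ * _).
by rewrite -expfB_cond // (negPf pt_neq0) add0n -ltnS.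
Qed.

(** Changing the parametrization of a line at a fixed point substitutes
    (x + y t, z t) in the binary form, which preserves divisibility by t^k. *)
Lemma dvd_form_restr_indep d k A a b x y z : A \is d.-homog -> x != 0 ->
  'X^k %| form_restr A a b -> 'X^k %| form_restr A (x *: a) (y *: a + z *: b).
Proof.
move=> hA x0 kA.
have -> : form_restr A (x *: a) (y *: a + z *: b) =
   mmap polyC (fun i => (x%:P + y *: 'X) * (a 0 i)%:P + (z *: 'X) * (b 0 i)%:P) A.
  apply: mmap_ext => i; rewrite !mxE polyCM -!mul_polyC polyCD !polyCM; ring.
rewrite (binary_form a b (z *: 'X) hA); last first.
  apply: contra_neq x0 => /(congr1 (fun p : {poly K} => p`_0)).
  by rewrite coefD coefC coefZ coefX /= mulr0 addr0 coef0.
apply: (big_ind (fun P : {poly K} => 'X^k %| P)) => [|P Q|j _]; [exact: dvdp0 | exact: dvdp_add |].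
have [ljk|lkj] := ltnP j k.
  have -> : (form_restr A a b)`_j = 0; last by rewrite scale0r dvdp0.
  by have /dvdpP[r ->] := kA; rewrite coefMXn ljk.
rewrite -mul_polyC; do 2 apply: dvdp_mull.
by rewrite exprZn -mul_polyC dvdp_mull // dvdp_exp2l.
Qed.

End Lines.

(** * Linear forms *)

Section LinearForms.
Variable K : closedFieldType.
Implicit Types (A B C : {mpoly K[3]}) (a b u v w l : 'rV[K]_3) (p q : {poly K}).

Definition lin l : {mpoly K[3]} := \sum_i l 0 i *: 'X_i.

Lemma meval_lin l v : (lin l).@[v 0] = \sum_i l 0 i * v 0 i.
Proof.
rewrite /lin raddf_sum; apply: eq_bigr => i _ /=.
by rewrite mevalZ mevalXU.
Qed.

Lemma mmap_lin (S : comNzRingType) (f : {rmorphism K -> S}) (x : 'I_3 -> S) l :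
  mmap f x (lin l) = \sum_i f (l 0 i) * x i.
Proof.
rewrite /lin raddf_sum; apply: eq_bigr => i _ /=.
by rewrite mmapZ mmapX mmap1U.
Qed.

Lemma lin_homog l : lin l \is 1.-homog.
Proof. by apply: rpred_sum => i _; apply: rpredZ; rewrite dhomogX /= mdeg1. Qed.

Lemma mcoeff_lin l i : (lin l)@_(U_(i)) = l 0 i.
Proof.
rewrite /lin raddf_sum (bigD1 i) //= big1 ?addr0 => [|j ji]; rewrite mcoeffZ mcoeffXU.
  by rewrite eqxx mulr1.
by rewrite (negPf ji) mulr0.
Qed.

Lemma homog1_lin A : A \is 1.-homog -> exists l, A = lin l.
Proof.
move=> hA; exists (\row_i A@_(U_(i))); apply/mpolyP => m.
have [/mdeg1P[i /eqP ->]|m1] := boolP (mdeg m == 1%N).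
  by rewrite mcoeff_lin mxE.
by rewrite !(dhomog_nemf_coeff _ m1) // lin_homog.
Qed.

Lemma lin_neq0 l : l != 0 -> lin l != 0.
Proof.
apply: contra_neq => l0; apply/rowP => i.
by rewrite -mcoeff_lin l0 mcoeff0 mxE.
Qed.

(** Reduction modulo the linear form l: eliminating the variable x_j, when
    l_j <> 0, gives a ring endomorphism with kernel generated by l.  As its target is a domain, this
    shows at once that l generates a prime ideal and that this ideal consists of
    all polynomials vanishing on the plane l = 0. *)
Definition retract l (j : 'I_3) : {mpoly K[3]} -> {mpoly K[3]} :=
  mmap (@mpolyC 3 K) (fun i => 'X_i - ((i == j)%:R / l 0 j) *: lin l).

Lemma retractE l j A : exists B, A = retract l j A + lin l * B.
Proof.
elim/mpoly_alg_ind: A => [c|i|A A' [B e] [B' e']|A A' [B e] [B' e']].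
- by exists 0; rewrite /retract mmapC mulr0 addr0.
- exists ((i == j)%:R / l 0 j)%:MP.
  by rewrite /retract mmapX mmap1U [lin l * _]mulrC mul_mpolyC subrK.
- by exists (B + B'); rewrite /retract mmapD {1}e {1}e' mulrDr addrACA.
- exists (B * retract l j A' + retract l j A * B' + lin l * B * B').
  rewrite /retract rmorphM /= -/(retract l j A) -/(retract l j A') {1}e {1}e'; ring.
Qed.

Lemma retract_eq0 l j A : l 0 j != 0 ->
  (forall v, (lin l).@[v 0] = 0 -> A.@[v 0] = 0) -> retract l j A = 0.
Proof.
move=> lj A0; apply: mpoly_fun_eq0 => v.
pose w := v - ((lin l).@[v 0] / l 0 j) *: delta_mx 0 j.
have -> : (retract l j A).@[v 0] = A.@[w 0].
  have -> := @mmap_comp _ _ _ (@mpolyC 3 K) idfun (meval (v 0))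
    (fun i => 'X_i - ((i == j)%:R / l 0 j) *: lin l) A.
    apply: mmap_ext => i /=; rewrite mevalB mevalZ mevalXU !mxE eqxx andTb; ring.
  by move=> c; apply: mevalC.
apply: A0; rewrite meval_lin.
under eq_bigr do rewrite !mxE eqxx andTb mulrBr.
rewrite sumrB -meval_lin [X in _ - X](bigD1 j) //= big1 ?addr0 => [|i ij].
  by rewrite eqxx mulr1 mulrC divfK // subrr.
by rewrite (negPf ij) !mulr0.
Qed.

Lemma lin_dvd l A : l != 0 ->
  (forall v, (lin l).@[v 0] = 0 -> A.@[v 0] = 0) -> exists B, A = lin l * B.
Proof.
move=> /rV0Pn[j lj] A0; have [B ->] := retractE l j A.
by rewrite (retract_eq0 lj A0) add0r; exists B.
Qed.

Lemma lin_prime l A B C : l != 0 -> A * B = lin l * C ->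
  (exists A', A = lin l * A') \/ (exists B', B = lin l * B').
Proof.
move=> /rV0Pn[j lj] e.
have l0 : retract l j (lin l) = 0 by apply: retract_eq0.
have := congr1 (retract l j) e; rewrite /retract !rmorphM /= -!/(retract l j _) l0.
rewrite mul0r => /eqP; rewrite mulf_eq0 => /orP[]/eqP e0; [left|right].
  by have [D ->] := retractE l j A; exists D; rewrite e0 add0r.
by have [D ->] := retractE l j B; exists D; rewrite e0 add0r.
Qed.

Lemma pihomogM_lin d l A :
  pihomog mdeg d.+1 (lin l * A) = lin l * pihomog mdeg d A.
Proof.
elim/mpolyind: A => [|c m A _ _ IH]; first by rewrite !(mulr0, pihomog0).
rewrite mulrDr !pihomogD mulrDr IH; congr (_ + _).
rewrite -scalerAr !linearZ /= -scalerAr; congr (_ *: _).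
have hm : lin l * 'X_[m] \is (mdeg m).+1.-homog.
  by rewrite -[(mdeg m).+1]add1n dhomogM ?lin_homog // dhomogX.
rewrite pihomogX; have [<-|dm] := eqVneq (mdeg m) d; first by rewrite pihomog_dE.
by rewrite mulr0 (pihomog_ne0 _ hm).
Qed.

Lemma homog_lin_quot d l A : l != 0 -> lin l * A \is d.+1.-homog -> A \is d.-homog.
Proof.
move=> l0; rewrite !homog_piE pihomogM_lin => /eqP e.
by apply/eqP/(mulfI (lin_neq0 l0)).
Qed.

End LinearForms.

(** * Points and lines of the plane *)

Section Geometry.
Variable K : closedFieldType.
Implicit Types (A B C : {mpoly K[3]}) (a b u v w l : 'rV[K]_3) (p q : {poly K}).
Implicit Types (F : cubic K) (P Q S X Y : point K) (L M : line K).

Lemma dim_point u : u != 0 -> \dim <[u]>%VS == 1%N.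
Proof. by move=> u0; rewrite dim_vline u0. Qed.

Definition point_of u (u0 : u != 0) : point K := Point (dim_point u0).

Lemma pointE X u : u != 0 -> u \in (X : {vspace _}) -> (X : {vspace _}) = <[u]>%VS.
Proof.
move=> u0 uX; apply/esym/eqP; rewrite eqEdim dim_vline u0 (eqP (point_dim X)) leqnn andbT.
by rewrite -memvE.
Qed.

Lemma point_vpick X : vpick X != 0.
Proof. by rewrite vpick0 -dimv_eq0 (eqP (point_dim X)). Qed.

Lemma vpickE X : (X : {vspace _}) = <[vpick X]>%VS.
Proof. by apply: pointE; rewrite ?point_vpick ?memv_pick. Qed.

Lemma point_inj X Y : (X : {vspace _}) = Y -> X = Y.
Proof. exact: val_inj. Qed.

Lemma point_eqP X u : (X : {vspace _}) = <[u]>%VS -> u != 0.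
Proof.
move=> XE; have := point_dim X; rewrite XE dim_vline.
by case: (u != 0).
Qed.

Lemma on_curveE F X u : (X : {vspace _}) = <[u]>%VS ->
  on_curve F X <-> (F : {mpoly K[3]}).@[u 0] = 0.
Proof.
move=> XE; split=> [h|Fu v]; first by apply: h; rewrite XE memv_line.
rewrite XE => /vlineP[k ->].
by rewrite (meval_homog _ _ (dhomog_is_dhomog F)) Fu mulr0.
Qed.

Lemma lin_mulmx (l v : 'rV[K]_3) : (lin l).@[v 0] = (v *m l^T) 0 0.
Proof. by rewrite meval_lin mxE; apply: eq_bigr => i _; rewrite mxE mulrC. Qed.

Lemma lin_comb l x y v w :
  (lin l).@[(x *: v + y *: w) 0] = x * (lin l).@[v 0] + y * (lin l).@[w 0].
Proof. by rewrite !lin_mulmx mulmxDl -!scalemxAl !mxE. Qed.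

Definition line_eq L l := l != 0 /\ forall v, (v \in (L : {vspace _})) = ((lin l).@[v 0] == 0).

(** The linear form as a map into the regular module, so that its kernel is
    available as a subspace. *)
Definition lform (l v : 'rV[K]_3) : K^o := (v *m l^T) 0 0.
Lemma lform_is_linear l : linear (lform l).
Proof. by move=> k x y; rewrite /lform mulmxDl -scalemxAl !mxE. Qed.
HB.instance Definition _ l :=
  GRing.isLinear.Build K 'rV[K]_3 K^o _ (lform l) (lform_is_linear l).

Lemma lker_lform l v : (v \in lker (linfun (lform l))) = ((lin l).@[v 0] == 0).
Proof. by rewrite memv_ker lfunE /= /lform lin_mulmx. Qed.

Lemma exists_form_neq0 l : l != 0 -> exists v, (lin l).@[v 0] != 0.
Proof.
move=> /rV0Pn[j lj]; exists (delta_mx 0 j); rewrite meval_lin (bigD1 j) //= big1 => [|i ij].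
  by rewrite mxE !eqxx mulr1 addr0.
by rewrite mxE (negPf ij) mulr0.
Qed.

Lemma dim_lker_lform l : l != 0 -> \dim (lker (linfun (lform l))) == 2%N.
Proof.
move=> l0; have := limg_ker_dim (linfun (lform l)) fullv.
rewrite capfv dimvf /dim /= mul1n.
have [v lv] := exists_form_neq0 l0.
have -> : \dim (limg (linfun (lform l))) = 1%N.
  apply/eqP; rewrite eqn_leq (leq_trans (dimvS (subvf _))) /=; last by rewrite dimvf.
  rewrite lt0n dimv_eq0 -lkerE; apply: contra lv => /subvP/(_ v (memvf _)).
  by rewrite lker_lform.
by rewrite addn1 => -[->].
Qed.

Definition line_of l (l0 : l != 0) : line K := Line (dim_lker_lform l0).

Lemma line_ofP l (l0 : l != 0) : line_eq (line_of l0) l.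
Proof. by split=> // v; apply: lker_lform. Qed.

Lemma exists_line_eq L : exists l, line_eq L l.
Proof.
pose M := (\matrix_(i < 2) (vbasis L)`_i : 'M[K]_(2, 3)).
have : kermx M^T != 0.
  rewrite -mxrank_eq0 mxrank_ker subn_eq0 -ltnNge mxrank_tr.
  exact: leq_ltn_trans (rank_leq_row _) _.
case/rowV0Pn => l /sub_kermxP lM l0; exists l; split=> // v.
suff -> : (L : {vspace _}) = lker (linfun (lform l)) by apply: lker_lform.
apply/eqP; rewrite eqEdim (eqP (line_dim L)) (eqP (dim_lker_lform l0)) leqnn andbT.
rewrite -(span_basis (vbasisP L)); apply/span_subvP => w wL; case: (nthP 0 wL) => i.
rewrite size_tuple => i2 <-; have {}i2 : (i < 2)%N by rewrite -(eqP (line_dim L)).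
rewrite lker_lform lin_mulmx.
have := congr1 (fun A : 'rV__ => A 0 (Ordinal i2)) lM.
by rewrite mxE [RHS]mxE mxE => e; rewrite -{2}e; apply/eqP/eq_bigr => j _; rewrite !mxE mulrC.
Qed.

Lemma line_inj L M : (L : {vspace _}) = M -> L = M.
Proof.
by case: L M => [L hL] [M hM] /= e; subst; rewrite (eq_irrelevance hL hM).
Qed.

Lemma line_basis X L u : (X : {vspace _}) = <[u]>%VS -> (X <= L)%VS ->
  (L : {vspace _}) = (<[u]> + <[vpick (L :\: X)]>)%VS.
Proof.
move=> XE XL; have := dimv_cap_compl L X.
rewrite (capv_idPr XL) (eqP (point_dim X)) (eqP (line_dim L)) add1n => -[d1].
have w0 : vpick (L :\: X) != 0 by rewrite vpick0 -dimv_eq0 d1.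
have LE : <[vpick (L :\: X)]>%VS = (L :\: X)%VS.
  by apply/eqP; rewrite eqEdim d1 dim_vline w0 -memvE memv_pick.
by rewrite LE -XE addvC addv_diff; apply/esym/addv_idPl.
Qed.

Lemma line_comb L u b : (L : {vspace _}) = (<[u]> + <[b]>)%VS ->
  forall v, v \in (L : {vspace _}) -> exists x y, v = x *: u + y *: b.
Proof.
move=> -> v /memv_addP[_ /vlineP[x ->]] [_ /vlineP[y ->] ->].
by exists x, y.
Qed.

Lemma line_free L u b x y : (L : {vspace _}) = (<[u]> + <[b]>)%VS ->
  x *: u + y *: b = 0 -> x = 0 /\ y = 0.
Proof.
move=> LE; have hL := line_dim L.
have hf : free [:: u; b].
  by rewrite /free span_cons span_seq1 -LE (eqP hL).
move/freeP: hf => hf e.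
have := hf (fun i => [:: x; y]`_i); rewrite !big_ord_recl big_ord0 /= addr0 => /(_ e) h.
by split; [exact: (h ord0) | exact: (h (lift ord0 ord0))].
Qed.

Lemma line_lform0 L l u b : line_eq L l -> (L : {vspace _}) = (<[u]> + <[b]>)%VS ->
  (lin l).@[u 0] = 0 /\ (lin l).@[b 0] = 0.
Proof.
move=> [_ hL] LE; split; apply/eqP; rewrite -hL LE.
  by rewrite (subvP (addvSl _ _)) ?memv_line.
by rewrite (subvP (addvSr _ _)) ?memv_line.
Qed.

(** The order of a form on a line at a point does not depend on the basis of the
    line adapted to the point. *)
Lemma dvd_form_restr_eq d k A X L u b u' b' : A \is d.-homog ->
  (X : {vspace _}) = <[u]>%VS -> (X : {vspace _}) = <[u']>%VS ->
  (L : {vspace _}) = (<[u]> + <[b]>)%VS -> (L : {vspace _}) = (<[u']> + <[b']>)%VS ->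
  ('X^k %| form_restr A u b) = ('X^k %| form_restr A u' b').
Proof.
move=> hA; wlog suff : u b u' b' / forall X1 : X = <[u]>%VS :> {vspace _},
   X = <[u']>%VS :> {vspace _} ->
  (L : {vspace _}) = (<[u]> + <[b]>)%VS -> (L : {vspace _}) = (<[u']> + <[b']>)%VS ->
  'X^k %| form_restr A u b -> 'X^k %| form_restr A u' b'.
  by move=> h *; apply/idP/idP; apply: h.
move=> XE XE' LE LE'; have u'0 := point_eqP XE'.
have : u' \in <[u]>%VS by rewrite -XE XE' memv_line.
case/vlineP => x u'E; have x0 : x != 0.
  by apply: contra_neq u'0 => x0; rewrite u'E x0 scale0r.
have [|y [z ->]] := line_comb LE (v := b').
  by rewrite LE' (subvP (addvSr _ _)) ?memv_line.
by rewrite u'E; apply: dvd_form_restr_indep hA _.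
Qed.

(** A form that vanishes along a line is divisible by its equation. *)
Lemma restr_line_neq0 F L l u b : line_eq L l -> (L : {vspace _}) = (<[u]> + <[b]>)%VS ->
  (forall A, (F : {mpoly K[3]}) <> lin l * A) -> form_restr F u b != 0.
Proof.
move=> [l0 hL] LE nd; apply/eqP => F0.
have hF := dhomog_is_dhomog F.
have [A /nd //] : exists A, (F : {mpoly K[3]}) = lin l * A.
apply: lin_dvd => // v /eqP; rewrite -hL => /(line_comb LE)[x [y ->]].
have [->|x0] := eqVneq x 0.
  by rewrite scale0r add0r (meval_homog _ _ hF) -(lead_form_restr u _ hF) F0 coef0 mulr0.
have -> : x *: u + y *: b = x *: (u + (y / x) *: b).
  by rewrite scalerDr scalerA mulrC divfK.
by rewrite (meval_homog _ _ hF) -horner_form_restr F0 horner0 mulr0.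
Qed.

(** The intersection multiplicity, defined with chosen vectors, can be read in
    every basis adapted to the point and the line. *)
Lemma int_mult_geq F L X u b k : (X : {vspace _}) = <[u]>%VS ->
  (L : {vspace _}) = (<[u]> + <[b]>)%VS -> form_restr F u b != 0 ->
  (k <= int_mult F L X)%N = ('X^k %| form_restr F u b).
Proof.
move=> XE LE F0; have hF := dhomog_is_dhomog F.
have XL : (X <= L)%VS by rewrite XE LE addvSl.
have LE' := line_basis (vpickE X) XL.
have e k' := dvd_form_restr_eq k' hF XE (vpickE X) LE LE'.
have F0' : form_restr F (vpick X) (vpick (L :\: X)) != 0.
  apply: contra_neq F0 => F0'; apply/eqP; rewrite -size_poly_eq0 -leqn0 leqNgt.
  apply/negP => s0; have := e (size (form_restr F u b)); rewrite F0' dvdp0 => /(dvdp_leq _).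
  by rewrite size_polyXn -size_poly_eq0 -lt0n s0 ltnn => /(_ isT).
by rewrite /int_mult mup_geq // subr0 e.
Qed.

End Geometry.

(** * Arcs along the branches of a smooth cubic *)

Section Branches.
Variable K : closedFieldType.
Implicit Types (A B C : {mpoly K[3]}) (a b c u v w l : 'rV[K]_3) (p q g : {poly K}).
Implicit Types (F : cubic K) (P Q S X Y : point K) (L M : line K).

(** A factor with nonzero constant term is a unit of K[[X]]. *)
Lemma dvdXn_unit k p q : q.[0] != 0 -> ('X^k %| p * q) = ('X^k %| p).
Proof.
move=> q0; rewrite Gauss_dvdpl // coprimep_expl // coprimep_sym.
by rewrite -[X in coprimep _ X]subr0 -polyC0 coprimep_XsubC rootE.
Qed.

Lemma dvdX p : ('X %| p) = (p.[0] == 0).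
Proof. by rewrite -[X in X %| _]subr0 -polyC0 dvdp_XsubCl rootE. Qed.

Lemma dvdXn_X k p : p.[0] != 0 -> ('X^k %| 'X * p) = (k <= 1)%N.
Proof.
move=> p0; rewrite dvdXn_unit //; apply/idP/idP => [/dvdp_leq|k1].
  by rewrite polyX_eq0 size_polyXn size_polyX; apply.
by rewrite -{2}['X]expr1 dvdp_exp2l.
Qed.

Definition dirderiv A u b := \sum_i (A^`M(i)).@[u 0] * b 0 i.

(** The arc u + t v + g(t) c. *)
Definition arc u v c g (i : 'I_3) : {poly K} :=
  (u 0 i)%:P + v 0 i *: 'X + g * (c 0 i)%:P.

Lemma mmap_polyC u A : mmap polyC (fun i => (u 0 i)%:P) A = (A.@[u 0])%:P.
Proof. by rewrite -(@mmap_comp _ _ _ idfun polyC polyC). Qed.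

Lemma form_restr_taylor A u b : exists E,
  form_restr A u b = (A.@[u 0])%:P + 'X * (dirderiv A u b)%:P + 'X^2 * E.
Proof.
have [E e] := mmap_taylor polyC (fun i => (u 0 i)%:P) (fun i => (b 0 i)%:P) 'X A.
exists E; rewrite mmap_polyC in e.
have -> : (dirderiv A u b)%:P = \sum_i mmap polyC (fun i => (u 0 i)%:P) A^`M(i) * (b 0 i)%:P.
  by rewrite raddf_sum; apply: eq_bigr => i _; rewrite mmap_polyC -polyCM.
rewrite -e; apply: mmap_ext => i.
by rewrite -mul_polyC mulrC.
Qed.

Lemma horner_form_restr0 A u b : (form_restr A u b).[0] = A.@[u 0].
Proof. by rewrite horner_form_restr scale0r addr0. Qed.

(** Along an arc A differs from its restriction to the line u + t v by a multiple
    of g, with the derivative of A in the direction c as leading factor. *)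
Lemma arc_restr A u v c g : g.[0] = 0 -> exists2 E,
  mmap polyC (arc u v c g) A = form_restr A u v + g * E & E.[0] = dirderiv A u c.
Proof.
move=> g0; have [E e] := mmap_taylor polyC (fun i => (u 0 i)%:P + v 0 i *: 'X)
  (fun i => (c 0 i)%:P) g A.
exists (\sum_i form_restr A^`M(i) u v * (c 0 i)%:P + g * E).
  by rewrite e mulrDr addrA expr2 mulrA.
rewrite hornerD hornerM g0 mul0r addr0 horner_sum; apply: eq_bigr => i _.
by rewrite hornerM hornerC horner_form_restr0.
Qed.

Lemma horner_arc0 A u v c g : g.[0] = 0 ->
  (mmap polyC (arc u v c g) A).[0] = A.@[u 0].
Proof.
move=> g0; have [E -> _] := arc_restr A u v c g0.
by rewrite hornerD hornerM g0 mul0r addr0 horner_form_restr0.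
Qed.

(** Newton's method: where the derivative in the direction c is not zero, the
    curve A = 0 is a graph g over the line u + t v, to any order. *)
Lemma newton A u v c n : A.@[u 0] = 0 -> dirderiv A u c != 0 ->
  exists2 g, g.[0] = 0 & 'X^n %| mmap polyC (arc u v c g) A.
Proof.
move=> Au dA; case: n => [|n]; first by exists 0; rewrite ?horner0 // dvd1p.
elim: n => [|n [g g0 gA]].
  by exists 0; rewrite ?horner0 // expr1 dvdX horner_arc0 ?horner0 // Au.
have [r rE] := dvdpP _ _ gA.
have [E e] := mmap_taylor polyC (arc u v c g) (fun i => (c 0 i)%:P)
  ((- r.[0] / dirderiv A u c)%:P * 'X^(n.+1)) A.
exists (g + (- r.[0] / dirderiv A u c)%:P * 'X^(n.+1)).
  by rewrite hornerD g0 hornerM hornerXn expr0n mulr0 addr0.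
have -> : mmap polyC (arc u v c (g + (- r.[0] / dirderiv A u c)%:P * 'X^(n.+1))) A =
  mmap polyC (fun i => arc u v c g i +
      (- r.[0] / dirderiv A u c)%:P * 'X^(n.+1) * (c 0 i)%:P) A.
  by apply: mmap_ext => i; rewrite /arc; ring.
rewrite e rE; set k := (_ / _)%:P; set D := \sum_i _.
have -> : r * 'X^(n.+1) + k * 'X^(n.+1) * D + (k * 'X^(n.+1)) ^+ 2 * E =
   'X^(n.+1) * (r + k * D + 'X^(n.+1) * k ^+ 2 * E) by ring.
rewrite (exprSr 'X n.+1) dvdp_mul2l ?expf_neq0 ?polyX_eq0 // dvdX.
rewrite !(hornerD, hornerM) hornerXn expr0n !mul0r addr0 hornerC.
have -> : D.[0] = dirderiv A u c.
  rewrite horner_sum; apply: eq_bigr => i _.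
  by rewrite hornerM hornerC horner_arc0.
by rewrite divfK // subrr.
Qed.

(** The largest contact order that has to be tested: nine points and a line
    section, in [noether_line]. *)
Definition arc_prec := 12%N.

(** An approximation of the branch of F at the point <u>, as a graph over its
    tangent <u, v> in a transversal direction c.  The vector c is normalized off
    the curve by F(c) = 1, so that the lines through c meet F in the roots of
    monic cubic polynomials. *)
Record branch F X u v c g : Prop := Branch {
  br_pt : (X : {vspace _}) = <[u]>%VS;
  br_span : forall w, exists x y z, w = x *: u + y *: v + z *: c;
  br_tangent : dirderiv F u v = 0;
  br_transv : dirderiv F u c != 0;
  br_monic : (F : {mpoly K[3]}).@[c 0] = 1;
  br_g0 : g.[0] = 0;
  br_curve : 'X^arc_prec %| mmap polyC (arc u v c g) F }.

Lemma homog_mderiv d A i : A \is d.+1.-homog -> A^`M(i) \is d.-homog.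
Proof.
move=> hA; apply/dhomogP => m; rewrite mcoeff_msupp mcoeff_mderiv => h.
have /(dhomog_mf hA) : (m + U_(i))%MM \in msupp A.
  by rewrite mcoeff_msupp; apply: contraNneq h => ->; rewrite mul0rn.
by rewrite /= mdegD mdeg1 addn1 => -[].
Qed.

Lemma dirderiv_lin A u : exists l, forall b, dirderiv A u b = (lin l).@[b 0].
Proof.
exists (\row_i (A^`M(i)).@[u 0]) => b; rewrite meval_lin.
by apply: eq_bigr => i _; rewrite mxE.
Qed.

(** Euler's relation at a point of the curve, which places u on the tangent. *)
Lemma dirderiv_self F u : (F : {mpoly K[3]}).@[u 0] = 0 -> dirderiv F u u = 0.
Proof.
move=> Fu; have [E e] := form_restr_taylor F u u.
have F0 : form_restr F u u = 0.
  apply: (@poly_fun_eq0 _ _ [::]) => t _.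
  rewrite horner_form_restr -[X in X + _]scale1r -scalerDl.
  by rewrite (meval_homog _ _ (dhomog_is_dhomog F)) Fu mulr0.
have := congr1 (fun p : {poly K} => p`_1) e.
rewrite F0 Fu polyC0 add0r coefD coefXM coefXnM /= -[_%:P`_0]horner_coef0 hornerC addr0.
by move=> <-; rewrite coef0.
Qed.

(** A direction c which lies neither on the curve nor on the tangent exists on the
    line joining a vector off the one to a vector off the other; a cube root
    normalizes it. *)
Lemma exists_branch F X : smooth F -> on_curve F X ->
  exists u v c g, branch F X u v c g.
Proof.
move=> smoothF XF; have hF := dhomog_is_dhomog F.
have [u uX [i Fi]] := smoothF X XF.
have u0 : u != 0.
  apply: contraNneq Fi => ->.
  by rewrite -(scale0r 0) (meval_homog _ _ (homog_mderiv i hF)) expr0n mul0r.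
have XE := pointE u0 uX; have /(on_curveE _ XE) Fu := XF.
have [l dl] := dirderiv_lin F u.
have l0 : l != 0.
  apply: contraNneq Fi => l0; have := dl (delta_mx 0 i).
  rewrite l0 meval_lin [RHS]big1 => [|j _]; last by rewrite mxE mul0r.
  rewrite /dirderiv (bigD1 i) //= big1 => [|j ji]; last by rewrite mxE (negPf ji) mulr0.
  by rewrite mxE !eqxx mulr1 addr0 => /eqP.
have [c1 Fc1] : exists c1, (F : {mpoly K[3]}).@[c1 0] != 0.
  apply/not_existsP => h; move: Fi; rewrite (@mpoly_fun_eq0 _ F) ?mderiv0 ?meval0 ?eqxx // => v.
  by apply/eqP; have := h v; case: eqP.
have [c2 lc2] := exists_form_neq0 l0.
(* Choose c on the line through c1 and c2, off the curve and off the tangent. *)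
have : form_restr F c1 c2 * form_restr (lin l) c1 c2 != 0.
  rewrite mulf_neq0 //.
    by apply: contraNneq Fc1 => e; rewrite -(horner_form_restr0 F c1 c2) e horner0.
  apply: contraNneq lc2 => e.
  by rewrite -(lead_form_restr c1 c2 (lin_homog l)) e coef0.
case/closed_nonrootP => t; rewrite rootE hornerM !horner_form_restr mulf_eq0 negb_or.
set c0 := c1 + t *: c2 => /andP[Fc0 lc0].
(* Scaling by a cube root of 1 / F(c0) gives F(c) = 1. *)
have [r] : exists r, root ('X^3 - ((F : {mpoly K[3]}).@[c0 0])^-1%:P) r.
  by apply/closed_rootP; rewrite size_XnsubC.
rewrite rootE !hornerE subr_eq0 => /eqP r3.
have r0 : r != 0.
  by apply: contraNneq Fc0 => r0; rewrite -invr_eq0 -r3 r0 expr0n.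
pose c := r *: c0.
have lc : (lin l).@[c 0] != 0.
  by rewrite (meval_homog _ _ (lin_homog l)) expr1 mulf_neq0.
pose T := line_of l0; have [_ hT] := line_ofP l0.
have uT : u \in (T : {vspace _}) by rewrite hT -dl dirderiv_self.
have XT : (X <= T)%VS by rewrite XE -memvE.
have TE := line_basis XE XT.
set v := vpick _ in TE.
have [_ lv] := line_lform0 (line_ofP l0) TE.
have [|g g0 gF] := @newton F u v c arc_prec Fu; first by rewrite dl.
exists u, v, c, g; split=> //; rewrite ?dl //.
  move=> w; pose z := (lin l).@[w 0] / (lin l).@[c 0].
  have : w - z *: c \in (T : {vspace _}).
    by rewrite hT -scaleN1r -[w]scale1r scalerA lin_comb mul1r mulN1r mulNr divfK ?scale1r ?subrr.
  case/(line_comb TE) => x [y e]; exists x, y, z.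
  by rewrite -e subrK.
by rewrite (meval_homog _ _ hF) r3 mulVf.
Qed.

End Branches.

(** * Contact of lines and forms with a branch *)

Section Division.
Variable K : closedFieldType.
Implicit Types (A B C : {mpoly K[3]}) (a b c u v w l : 'rV[K]_3) (p q g : {poly K}).
Implicit Types (P Q S X Y : point K) (L M : line K).
Variable F : cubic K.
Hypothesis smoothF : smooth F.
Hypothesis nolineF : forall l A, l != 0 -> (F : {mpoly K[3]}) <> lin l * A.

Lemma branch_on X u v c g : branch F X u v c g -> (F : {mpoly K[3]}).@[u 0] = 0.
Proof.
move=> br; apply/eqP; rewrite -(horner_arc0 F u v c (br_g0 br)) -dvdX.
by rewrite (dvdp_trans _ (br_curve br)) // -{1}['X]expr1 dvdp_exp2l.
Qed.

Lemma lin_arc l u v c g : mmap polyC (arc u v c g) (lin l) =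
  ((lin l).@[u 0])%:P + 'X * ((lin l).@[v 0])%:P + g * ((lin l).@[c 0])%:P.
Proof.
rewrite mmap_lin !meval_lin !raddf_sum !mulr_sumr -!big_split.
apply: eq_bigr => i _ /=; rewrite /arc !polyCM -mul_polyC; ring.
Qed.


(** The curve leaves its tangent exactly as fast as F grows along the tangent,
    since the derivative of F in the direction c is not zero. *)
Lemma branch_g_order X u v c g k : branch F X u v c g -> (k <= arc_prec)%N ->
  ('X^k %| g) = ('X^k %| form_restr F u v).
Proof.
move=> br kp; have [E e E0] := arc_restr F u v c (br_g0 br).
have kF : 'X^k %| mmap polyC (arc u v c g) F.
  by apply: dvdp_trans (br_curve br); apply: dvdp_exp2l.
rewrite -(@dvdXn_unit _ k g E) ?E0 ?br_transv //; last exact: br_transv br.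
have -> : form_restr F u v = mmap polyC (arc u v c g) F - g * E by rewrite e addrK.
by rewrite dvdp_subr.
Qed.

(** A line through a smooth point is the tangent, and then its intersection
    multiplicity is the order of g, or it crosses the curve simply. *)
Lemma branch_dichotomy X L l u v c g :
  branch F X u v c g -> line_eq L l -> (X <= L)%VS ->
  [/\ (L : {vspace _}) = (<[u]> + <[v]>)%VS, (lin l).@[v 0] = 0, (lin l).@[c 0] != 0 &
    forall k, (k <= arc_prec)%N -> ('X^k %| g) = (k <= int_mult F L X)%N] \/
  (lin l).@[v 0] != 0 /\ int_mult F L X = 1%N.
Proof.
move=> br hL XL; have [l0 lL] := hL.
have LE := line_basis (br_pt br) XL; set b := vpick _ in LE.
have F0 w : (L : {vspace _}) = (<[u]> + <[w]>)%VS -> form_restr F u w != 0.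
  by move=> h; apply: (restr_line_neq0 hL h) => A; apply: nolineF.
have [lu lb] := line_lform0 hL LE.
have lspan x y z : (lin l).@[(x *: u + y *: v + z *: c) 0] =
    y * (lin l).@[v 0] + z * (lin l).@[c 0].
  by rewrite -[_ + y *: v]scale1r !lin_comb lu mulr0 add0r mul1r.
have [lv|lv] := eqVneq (lin l).@[v 0] 0; [left|right].
  have lc : (lin l).@[c 0] != 0.
    apply/eqP => lc; have [w] := exists_form_neq0 l0.
    have [x [y [z ->]]] := br_span br w.
    by rewrite lspan lv lc !mulr0 addr0 eqxx.
  have LE' : (L : {vspace _}) = (<[u]> + <[v]>)%VS.
    apply/eqP; rewrite eqEsubv subv_add -!memvE !lL lu lv eqxx !andbT.
    apply/subvP => w; rewrite lL; have [x [y [z ->]]] := br_span br w.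
    rewrite lspan lv mulr0 add0r mulf_eq0 (negPf lc) orbF => /eqP ->.
    by rewrite scale0r addr0 memv_add ?memvZ ?memv_line.
  split=> // k kp.
  by rewrite (int_mult_geq k (br_pt br) LE' (F0 _ LE')) (branch_g_order br).
split=> //; have [E e] := form_restr_taylor F u b.
have db : dirderiv F u b != 0.
  apply/eqP => db; have [x [y [z bE]]] := br_span br b.
  have [m dm] := dirderiv_lin F u.
  have z0 : z = 0.
    move/eqP: db; rewrite dm bE -[_ + y *: v]scale1r !lin_comb -!dm.
    rewrite (br_tangent br) dirderiv_self ?(branch_on br) // !(mulr0, add0r) mulf_eq0.
    by rewrite (negPf (br_transv br)) orbF => /eqP.
  have y0 : y = 0.
    move/eqP: lb; rewrite bE z0 lspan mul0r addr0 mulf_eq0 (negPf lv) orbF.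
    by move/eqP.
  have [] := line_free (x := - x) (y := 1) LE; last by move=> _ /eqP; rewrite oner_eq0.
  by rewrite bE z0 y0 !scale0r !addr0 scale1r scaleNr addNr.
have im k : (k <= int_mult F L X)%N = (k <= 1)%N.
  rewrite (int_mult_geq k (br_pt br) LE (F0 _ LE)) e (branch_on br) polyC0 add0r.
  rewrite expr2 -mulrA -mulrDr dvdXn_X // hornerD hornerC hornerM hornerX mul0r.
  by rewrite addr0.
by apply/eqP; rewrite eqn_leq -im leqnn im.
Qed.

Lemma branch_u X u v c g L : branch F X u v c g -> (X <= L)%VS -> u \in (L : {vspace _}).
Proof. by move=> br; rewrite (br_pt br) memvE. Qed.

(** The multiplicity of a line at a point, defined by restricting the cubic to the
    line, is also the order of the line along the branch of the cubic. *)
Lemma lin_arc_order X L l u v c g k :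
  branch F X u v c g -> line_eq L l -> (X <= L)%VS -> (k <= arc_prec)%N ->
  ('X^k %| mmap polyC (arc u v c g) (lin l)) = (k <= int_mult F L X)%N.
Proof.
move=> br hL XL kp.
have lu : (lin l).@[u 0] = 0.
  by apply/eqP; case: hL => _ <-; apply: branch_u br XL.
rewrite lin_arc lu polyC0 add0r.
have [[LE lv lc gk]|[lv im]] := branch_dichotomy br hL XL.
  by rewrite lv polyC0 mulr0 add0r dvdXn_unit ?hornerC ?gk.
have : 'X^2 %| g.
  rewrite (branch_g_order br) //; have [E ->] := form_restr_taylor F u v.
  by rewrite (br_tangent br) (branch_on br) !polyC0 mulr0 !add0r dvdp_mulr.
case/dvdpP => r ->; rewrite im.
have -> : 'X * ((lin l).@[v 0])%:P + r * 'X^2 * ((lin l).@[c 0])%:P =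
  'X * (((lin l).@[v 0])%:P + 'X * (r * ((lin l).@[c 0])%:P)) by ring.
by rewrite dvdXn_X // hornerD hornerC hornerM hornerX mul0r addr0.
Qed.

(** The local step of the division by a line.  On a tangent line the restriction
    of A differs from A along the branch by a multiple of g, which has order
    [int_mult]; on any other line only the value at the point matters. *)
Lemma form_restr_order X L l u v c g k d A b :
  branch F X u v c g -> line_eq L l -> (X <= L)%VS -> (k <= arc_prec)%N ->
  (k <= int_mult F L X)%N -> A \is d.-homog ->
  (L : {vspace _}) = (<[u]> + <[b]>)%VS ->
  'X^k %| mmap polyC (arc u v c g) A -> 'X^k %| form_restr A u b.
Proof.
move=> br hL XL kp kim hA LE kA.
have [[LE' lv lc gk]|[lv im]] := branch_dichotomy br hL XL.
  rewrite (dvd_form_restr_eq k hA (br_pt br) (br_pt br) LE LE').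
  have [E e E0] := arc_restr A u v c (br_g0 br).
  have -> : form_restr A u v = mmap polyC (arc u v c g) A - g * E by rewrite e addrK.
  by rewrite dvdp_sub // dvdp_mulr // gk.
move: kim kA; rewrite im; case: k {kp} => [|[|k]] // _; first by rewrite expr0 !dvd1p.
by rewrite expr1 !dvdX horner_form_restr0 horner_arc0 // (br_g0 br).
Qed.

(** The intersection divisor of A with F is at least the divisor given by the
    sequence D, on the condition that D has no more than [arc_prec] points. *)
Definition vanishes A (D : seq (point K)) := forall X u v c g, branch F X u v c g ->
  'X^(count_mem X D) %| mmap polyC (arc u v c g) A.

End Division.

(** * Chords and tangents *)

Section Sections.
Variable K : closedFieldType.
Implicit Types (A B C : {mpoly K[3]}) (a b c u v w l : 'rV[K]_3) (p q g : {poly K}).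
Implicit Types (P Q S X Y : point K) (L M : line K).
Variable F : cubic K.
Hypothesis smoothF : smooth F.
Hypothesis nolineF : forall l A, l != 0 -> (F : {mpoly K[3]}) <> lin l * A.

Lemma dvdp_comp_poly p q r : p %| q -> p \Po r %| q \Po r.
Proof. by case/dvdpP => s ->; rewrite comp_polyM dvdp_mull. Qed.

Lemma form_restr_shift A a w (r : K) :
  form_restr A a w \Po ('X + r%:P) = form_restr A (a + r *: w) w.
Proof.
apply: (@poly_fun_inj _ _ _ [::]) => t _.
by rewrite horner_comp !horner_form_restr !hornerE scalerDl addrA addrAC.
Qed.

Lemma dvdp_form_restr_shift A a w (r : K) k :
  (('X - r%:P) ^+ k %| form_restr A a w) = ('X^k %| form_restr A (a + r *: w) w).
Proof.
apply/idP/idP => /dvdp_comp_poly h.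
  have := h ('X + r%:P); rewrite form_restr_shift rmorphXn /= comp_polyB comp_polyX comp_polyC.
  by rewrite addrK.
have := h ('X - r%:P); rewrite rmorphXn /= comp_polyX.
have -> : 'X - r%:P = 'X + (- r)%:P by rewrite polyCN.
by rewrite form_restr_shift -addrA scaleNr subrr addr0.
Qed.

Lemma restr_neq0 L u b : (L : {vspace _}) = (<[u]> + <[b]>)%VS -> form_restr F u b != 0.
Proof.
have [l hL] := exists_line_eq L; move=> LE; apply: (restr_line_neq0 hL LE) => A.
by case: hL => l0 _; apply: nolineF.
Qed.

Lemma on_curve_int_mult L X : (X <= L)%VS -> on_curve F X <-> (0 < int_mult F L X)%N.
Proof.
move=> XL; have LE := line_basis (vpickE X) XL.
rewrite (int_mult_geq 1 (vpickE X) LE (restr_neq0 LE)) expr1 dvdX horner_form_restr0.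
by rewrite (on_curveE _ (vpickE X)); split => /eqP.
Qed.

Lemma span_shear a b (t : K) : (<[a]> + <[b]> = <[b]> + <[a + t *: b]>)%VS.
Proof.
apply/eqP; rewrite eqEsubv !subv_add -!memvE addrC -andbA.
have h1 x : x *: b + a \in (<[a]> + <[b]>)%VS.
  by rewrite addrC memv_add ?memvZ ?memv_line.
apply/and4P; split.
- apply/memv_addP; exists (- t *: b); first by rewrite memvZ ?memv_line.
  by exists (t *: b + a); rewrite ?memv_line // addrA -scalerDl addNr scale0r add0r.
- by rewrite (subvP (addvSl _ _)) ?memv_line.
- by rewrite (subvP (addvSr _ _)) ?memv_line.
- exact: h1.
Qed.

(** With w off the curve, all points of F on the line L have the form
    a + r w. *)
Lemma line_good_basis L : exists a w,
  (L : {vspace _}) = (<[a]> + <[w]>)%VS /\ (F : {mpoly K[3]}).@[w 0] != 0.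
Proof.
have u0 : vpick L != 0 by rewrite vpick0 -dimv_eq0 (eqP (line_dim L)).
have LE := @line_basis _ (point_of u0) L _ erefl (memv_pick L).
set b := vpick (_ :\: _) in LE.
have /closed_nonrootP[t] := restr_neq0 LE; rewrite rootE horner_form_restr => Ft.
by exists b, (vpick L + t *: b); rewrite -span_shear.
Qed.

Lemma size_restr_cubic a w : (F : {mpoly K[3]}).@[w 0] != 0 -> size (form_restr F a w) = 4%N.
Proof.
move=> Fw; have hF := dhomog_is_dhomog F.
apply/eqP; rewrite eqn_leq (size_form_restr _ _ hF) /=; apply: contraNT Fw.
rewrite -leqNgt => /leq_sizeP/(_ 3%N (leqnn _)).
by rewrite (lead_form_restr _ _ hF) => ->.
Qed.

Lemma line_vec_neq0 L a w (r : K) : (L : {vspace _}) = (<[a]> + <[w]>)%VS -> a + r *: w != 0.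
Proof.
move=> LE; apply/eqP => e; have [] := line_free (x := 1) (y := r) LE; rewrite ?scale1r //.
by move/eqP; rewrite oner_eq0.
Qed.

Lemma span_affine L a w (r : K) : (L : {vspace _}) = (<[a]> + <[w]>)%VS ->
  (L : {vspace _}) = (<[a + r *: w]> + <[w]>)%VS.
Proof. by move=> ->; rewrite (span_shear _ _ r) addvC. Qed.

Lemma int_mult_root L a w (r : K) X : (L : {vspace _}) = (<[a]> + <[w]>)%VS ->
  (X : {vspace _}) = <[a + r *: w]>%VS -> int_mult F L X = mup r (form_restr F a w).
Proof.
move=> LE XE; have LE' := span_affine r LE.
suff e k : (k <= int_mult F L X)%N = (k <= mup r (form_restr F a w))%N.
  by apply/eqP; rewrite eqn_leq -e leqnn e leqnn.
rewrite (int_mult_geq k XE LE' (restr_neq0 LE')) (mup_geq _ _ (restr_neq0 LE)).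
by rewrite dvdp_form_restr_shift.
Qed.

Lemma line_point L a w X : (L : {vspace _}) = (<[a]> + <[w]>)%VS -> (X <= L)%VS ->
  (X : {vspace _}) = <[w]>%VS \/ exists r, (X : {vspace _}) = <[a + r *: w]>%VS.
Proof.
move=> LE XL; have [|x [y e]] := line_comb LE (v := vpick X).
  by rewrite (subvP XL) ?memv_pick.
have X0 := point_vpick X.
have [x0|x0] := eqVneq x 0; [left|right].
  apply: pointE.
    by apply: contraNneq X0 => w0; rewrite e x0 w0 scale0r scaler0 addr0.
  have y0 : y != 0 by apply: contraNneq X0 => y0; rewrite e x0 y0 !scale0r addr0.
  have -> : w = y^-1 *: vpick X by rewrite e x0 scale0r add0r scalerA mulVf ?scale1r.
  by rewrite memvZ ?memv_pick.
exists (y / x); apply: pointE; first exact: line_vec_neq0 LE.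
have -> : a + y / x *: w = x^-1 *: vpick X.
  by rewrite e scalerDr !scalerA mulVf // scale1r mulrC.
by rewrite memvZ ?memv_pick.
Qed.

(** The restriction of F to the line has degree three and splits. *)
Lemma exists_section L : exists P Q S, line_section F L P Q S.
Proof.
have [a [w [LE Fw]]] := line_good_basis L.
pose pnt r := point_of (line_vec_neq0 r LE).
have pntE r : (pnt r : {vspace _}) = <[a + r *: w]>%VS by [].
have pnt_inj : injective pnt.
  move=> r r' e; have : a + r *: w \in (pnt r' : {vspace _}) by rewrite -e memv_line.
  case/vlineP => k ek; have [] := line_free (x := 1 - k) (y := r - k * r') LE.
    rewrite !scalerBl scale1r -scalerA addrACA -opprD ek scalerDr; exact: subrr.
  by move/subr0_eq <- => /subr0_eq; rewrite mul1r.
have pL r : (pnt r <= L)%VS by rewrite (span_affine r LE) pntE addvSl.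
have [s ps] := closed_field_poly_normal (form_restr F a w).
have p0 := restr_neq0 LE.
have l0 : lead_coef (form_restr F a w) != 0 by rewrite lead_coef_eq0.
have := size_restr_cubic a Fw; rewrite {1}ps size_scale // size_prod_XsubC => -[s3].
have cnt X : (X <= L)%VS -> int_mult F L X = count_mem X (map pnt s).
  move=> XL; have [XE|[r XE]] := line_point LE XL.
    have nX : ~ on_curve F X by rewrite (on_curveE _ XE); apply/eqP.
    have -> : int_mult F L X = 0%N.
      by apply/eqP; rewrite -leqn0 leqNgt; apply/negP => /(on_curve_int_mult XL).
    apply/esym/count_memPn/mapP => -[r _ Xr].
    have : a + r *: w \in <[w]>%VS by rewrite -XE Xr pntE memv_line.
    case/vlineP => k ek; have [] := line_free (x := 1) (y := r - k) LE.
      by rewrite scale1r scalerBl addrA ek subrr.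
    by move/eqP; rewrite oner_eq0.
  have -> : X = pnt r by apply: point_inj; rewrite XE.
  rewrite (int_mult_root LE (pntE r)) ps -mul_polyC mupMr ?mu_prod_XsubC.
    rewrite count_map; apply: eq_count => z /=.
    by rewrite (inj_eq pnt_inj).
  by rewrite rootE hornerC.
case: s s3 cnt {ps} => [|z1 [|z2 [|z3 [|]]]] //= _ cnt.
by exists (pnt z1), (pnt z2), (pnt z3); split.
Qed.

Lemma line_section_perm L P Q S P' Q' S' : perm_eq [:: P; Q; S] [:: P'; Q'; S'] ->
  line_section F L P Q S -> line_section F L P' Q' S'.
Proof.
move=> e [PL QL SL cnt].
have h X : X \in [:: P'; Q'; S'] -> (X <= L)%VS.
  by rewrite -(perm_mem e) !inE => /or3P[] /eqP ->.
split; try by apply: h; rewrite !inE eqxx ?orbT.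
by move=> X /cnt ->; apply/permP.
Qed.

Lemma section_on_curve L P Q S X : line_section F L P Q S -> X \in [:: P; Q; S] ->
  on_curve F X.
Proof.
move=> [PL QL SL cnt] XD; have XL : (X <= L)%VS.
  by move: XD; rewrite !inE => /or3P[] /eqP ->.
by apply/(on_curve_int_mult XL); rewrite cnt // -has_count has_pred1.
Qed.

Lemma tangent_line L X u v c g : branch F X u v c g -> (X <= L)%VS ->
  (2 <= int_mult F L X)%N <-> (L : {vspace _}) = (<[u]> + <[v]>)%VS.
Proof.
move=> br XL; have [l hL] := exists_line_eq L; split=> [i2|LE].
  have [[]//|[_ i1]] := branch_dichotomy nolineF br hL XL.
  by rewrite i1 in i2.
rewrite (int_mult_geq 2 (br_pt br) LE (restr_neq0 LE)).
have [E ->] := form_restr_taylor F u v.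
by rewrite (br_tangent br) (branch_on br) !polyC0 mulr0 !add0r dvdp_mulr.
Qed.

Lemma dim_two_points P Q : P != Q -> \dim (P + Q)%VS == 2%N.
Proof.
move=> PQ; have := dimv_sum_cap P Q; rewrite (eqP (point_dim P)) (eqP (point_dim Q)).
suff -> : (P :&: Q)%VS = 0%VS by rewrite dimv0 addn0 => ->.
apply/eqP; rewrite -dimv_eq0; apply: contraNT PQ; rewrite -lt0n => d.
have d1 Y : (P :&: Q <= Y)%VS -> (P :&: Q)%VS = Y.
  move=> s; apply/eqP; rewrite eqEdim s (eqP (point_dim Y)) d //.
by apply/eqP/point_inj; rewrite -(d1 P) ?capvSl // (d1 Q) ?capvSr.
Qed.

(** Two distinct points determine the line; a double point determines it as the
    tangent.  The third point is then given by the multiplicities. *)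
Lemma section_line_unique L L' P Q S S' :
  line_section F L P Q S -> line_section F L' P Q S' -> L = L' /\ S = S'.
Proof.
move=> h h'; have [PL QL SL cnt] := h; have [PL' QL' SL' cnt'] := h'.
have LL' : L = L'.
  have [e|PQ] := eqVneq P Q; last first.
    have eqL M : (P <= M)%VS -> (Q <= M)%VS -> (P + Q)%VS = M.
      move=> PM QM; apply/eqP; rewrite eqEdim subv_add PM QM.
      by rewrite (eqP (dim_two_points PQ)) (eqP (line_dim M)).
    by apply: line_inj; rewrite -(eqL L) // (eqL L').
  subst Q; have [|u [v [c [g br]]]] := exists_branch smoothF (X := P).
    by apply: (section_on_curve h); rewrite inE eqxx.
  have i2 M : (P <= M)%VS -> (2 <= int_mult F M P)%N -> (M : {vspace _}) = (<[u]> + <[v]>)%VS.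
    by move=> PM; rewrite (tangent_line br).
  have c2 : (2 <= count_mem P [:: P; P; S])%N by rewrite /= eqxx.
  have c2' : (2 <= count_mem P [:: P; P; S'])%N by rewrite /= eqxx.
  apply: line_inj; transitivity (<[u]> + <[v]>)%VS; first by apply: i2; rewrite ?cnt.
  by apply/esym; apply: i2; rewrite ?cnt'.
split=> //; subst L'; have := cnt S SL; rewrite cnt' //= eqxx => /eqP.
by rewrite !addnA !addn0 eqn_add2l => /eqP; case: eqP.
Qed.



(** The section by the line through P and Q, or by the tangent if P = Q, contains
    P + Q and has three points. *)
Lemma exists_chord P Q : on_curve F P -> on_curve F Q ->
  exists L S, line_section F L P Q S.
Proof.
move=> PF QF; suff [L [PL QL PQ]] : exists L, [/\ (P <= L)%VS, (Q <= L)%VS &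
    P = Q -> (2 <= int_mult F L P)%N].
  have [P' [Q' [S' sec]]] := exists_section L; have [_ _ _ cnt] := sec.
  set D := [:: P'; Q'; S'] in sec cnt.
  have PD : P \in D by rewrite -has_pred1 has_count -cnt //; apply/on_curve_int_mult.
  have QD : Q \in rem P D.
    rewrite -has_pred1 has_count count_rem PD andTb -cnt //= subn_gt0.
    have [e|_] := eqVneq P Q; last by apply/on_curve_int_mult.
    by rewrite -e; apply: PQ.
  have e := perm_to_rem PD; have e' := perm_to_rem QD.
  have e2 : perm_eq D [:: P, Q & rem Q (rem P D)].
    by apply: perm_trans e _; rewrite perm_cons.
  have s1 : size (rem Q (rem P D)) = 1%N by rewrite !size_rem.
  case: (rem Q (rem P D)) s1 e2 => [|S []] // _ e2.
  by exists L, S; apply: line_section_perm sec.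
have [e|PQ] := eqVneq P Q; last first.
  exists (Line (dim_two_points PQ)); rewrite addvSl addvSr; split=> // e.
  by case/eqP: PQ.
subst Q; have [u [v [c [g br]]]] := exists_branch smoothF PF.
have [l dl] := dirderiv_lin F u.
have l0 : l != 0.
  apply: contraNneq (br_transv br) => l0; rewrite dl l0 meval_lin big1 // => i _.
  by rewrite mxE mul0r.
have [_ hL] := line_ofP l0.
have PL : (P <= line_of l0)%VS.
  by rewrite (br_pt br) -memvE hL -dl dirderiv_self // (branch_on br).
exists (line_of l0); split=> // _; apply/(tangent_line br PL).
have [[//]|[lv _]] := branch_dichotomy nolineF br (line_ofP l0) PL.
by rewrite -dl (br_tangent br) eqxx in lv.
Qed.

Lemma thirdP P Q : on_curve F P -> on_curve F Q ->
  exists L, line_section F L P Q (third F P Q).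
Proof.
move=> PF QF; have [L [S h]] := exists_chord PF QF.
by apply: (@classical_sets.xgetPex _ P (fun T => exists L, line_section F L P Q T)); exists S, L.
Qed.

Lemma third_on P Q : on_curve F P -> on_curve F Q -> on_curve F (third F P Q).
Proof.
move=> PF QF; have [L h] := thirdP PF QF.
by apply: section_on_curve h _; rewrite !inE eqxx !orbT.
Qed.

Lemma third_unique L P Q S : line_section F L P Q S -> third F P Q = S.
Proof.
move=> h; have on X := section_on_curve h (X := X).
have PF : on_curve F P by apply: on; rewrite inE eqxx.
have QF : on_curve F Q by apply: on; rewrite !inE eqxx orbT.
by have [L' h'] := thirdP PF QF; have [_] := section_line_unique h' h.
Qed.

Lemma cadd_on o P Q : on_curve F o -> on_curve F P -> on_curve F Q ->
  on_curve F (cadd F o P Q).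
Proof. by move=> oF PF QF; apply/third_on/third_on. Qed.

Lemma cmul_on o n P : on_curve F o -> on_curve F P -> on_curve F (cmul F o n P).
Proof. by move=> oF PF; elim: n => //= n IH; apply: cadd_on. Qed.

(** The section by the flex tangent contains 3 o and has three points. *)
Lemma flex_section o : flex F o -> exists L, line_section F L o o o.
Proof.
move=> [oF [L [oL i3]]]; have [u [v [c [g br]]]] := exists_branch smoothF oF.
have [L' [S sec]] := exists_chord oF oF; have [oL' _ SL' cnt] := sec.
have LL' : L = L'.
  apply: line_inj; rewrite (tangent_line br oL).1 ?(ltnW i3) //.
  by rewrite (tangent_line br oL').1 // cnt //= eqxx.
move: i3; rewrite LL' cnt //= eqxx; case: eqP => [So _|//].
by exists L'; rewrite -{3}So.
Qed.

End Sections.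

(** * Division by a line modulo the cubic *)

Section Noether.
Variable K : closedFieldType.
Implicit Types (A B C : {mpoly K[3]}) (a b c u v w l : 'rV[K]_3) (p q g : {poly K}).
Implicit Types (P Q S X Y : point K) (L M : line K).
Variable F : cubic K.
Hypothesis smoothF : smooth F.
Hypothesis nolineF : forall l A, l != 0 -> (F : {mpoly K[3]}) <> lin l * A.

(** Distinct linear factors are coprime, so it suffices to divide by the power of
    each one. *)
Lemma dvdp_prod_XsubC (s : seq K) q :
  (forall z, ('X - z%:P) ^+ (count_mem z s) %| q) -> \prod_(z <- s) ('X - z%:P) %| q.
Proof.
elim: s q => [|z s IH] q h; first by rewrite big_nil dvd1p.
have : 'X - z%:P %| q.
  by apply: dvdp_trans (h z); rewrite /= eqxx add1n exprS dvdp_mulr.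
case/dvdpP => r qE; rewrite big_cons mulrC qE dvdp_mul2r ?polyXsubC_eq0 //.
apply: IH => y; have := h y; rewrite qE /=; have [->|zy] := eqVneq z y.
  by rewrite add1n exprSr dvdp_mul2r ?polyXsubC_eq0.
by rewrite add0n Gauss_dvdpl // coprimep_expl // coprimep_XsubC root_XsubC.
Qed.

(** Coordinates on a line, extended to the plane. *)
Lemma dual_forms L u w : (L : {vspace _}) = (<[u]> + <[w]>)%VS ->
  exists l l', [/\ (lin l).@[u 0] = 1, (lin l).@[w 0] = 0,
    (lin l').@[u 0] = 0 & (lin l').@[w 0] = 1].
Proof.
move=> LE; pose t : 2.-tuple 'rV[K]_3 := [tuple u; w].
have fr : free t by rewrite /free span_cons span_seq1 -LE (eqP (line_dim L)).
pose l i := \row_j coord t i (delta_mx 0 j).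
have lE i v : (lin (l i)).@[v 0] = coord t i v.
  rewrite meval_lin [v in RHS]row_sum_delta linear_sum; apply: eq_bigr => j _.
  by rewrite mxE linearZ mulrC.
exists (l ord0), (l ord_max); rewrite !lE.
have uE : u = t`_(ord0 : 'I_2) by [].
have wE : w = t`_(ord_max : 'I_2) by [].
by rewrite {1}uE {1}wE {1}uE {1}wE !coord_free.
Qed.

(** On the line L the form A vanishes at the points of F with at least their
    multiplicities, so A|L = F|L h.  Homogenizing h to a form H on the plane
    makes A - F H vanish on L.  Contact orders along F are additive, hence
    dividing by l removes exactly P + Q + S. *)
Lemma noether_line d A P Q S L l (D : seq (point K)) :
  A \is d.+1.-homog -> line_section F L P Q S -> line_eq L l ->
  vanishes F A [:: P, Q, S & D] -> (size D <= 9)%N ->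
  exists A' H, [/\ A = lin l * A' + (F : {mpoly K[3]}) * H, A' \is d.-homog,
     H \is (d - 2).-homog, (d < 2)%N -> H = 0 & vanishes F A' D].
Proof.
move=> hA sec hL vA sD; have [PL QL SL cnt] := sec; have [l0 lL] := hL.
have hF := dhomog_is_dhomog F.
have [a [w [LE Fw]]] := line_good_basis nolineF L.
set p := form_restr F a w; set q := form_restr A a w.
have p0 : p != 0 by apply: (restr_neq0 nolineF LE).
have c3 X : (count_mem X [:: P; Q; S] <= 3)%N by apply: count_size.
have : p %| q.
  have [s ps] := closed_field_poly_normal p.
  rewrite [X in X %| _]ps dvdpZl ?lead_coef_eq0 //.
  apply: dvdp_prod_XsubC => z; pose X := point_of (line_vec_neq0 z LE).
  have XE : (X : {vspace _}) = <[a + z *: w]>%VS by [].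
  have LEz := span_affine z LE.
  have XL : (X <= L)%VS by rewrite LEz addvSl.
  have -> : count_mem z s = count_mem X [:: P; Q; S].
    rewrite -cnt // (int_mult_root nolineF LE XE) -/p ps -mul_polyC mupMr ?mu_prod_XsubC //.
    by rewrite rootE hornerC lead_coef_eq0.
  set k := count_mem X _.
  have [->|k0] := posnP k; first by rewrite expr0 dvd1p.
  have [|u [v [c [g br]]]] := exists_branch smoothF (X := X).
    by apply/(on_curve_int_mult nolineF XL); rewrite cnt.
  have LEu := line_basis (br_pt br) XL.
  rewrite dvdp_form_restr_shift -(dvd_form_restr_eq k hA (br_pt br) XE LEu LEz).
  apply: (form_restr_order nolineF br hL XL _ _ hA LEu).
  - exact: leq_trans (c3 X) _.
  - by rewrite cnt.
  apply: dvdp_trans (vA _ _ _ _ _ br); rewrite dvdp_exp2l //.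
  by rewrite -[[:: P, Q, S & D]]/([:: P; Q; S] ++ D) count_cat leq_addr.
case/dvdpP => h qE.
have sh : (size h <= d.-1)%N.
  have [->|h0] := eqVneq h 0; first by rewrite size_poly0.
  have := size_form_restr a w hA; rewrite -/q qE size_mul // size_restr_cubic //.
  by rewrite addnS /= addn3 !ltnS; case: (d) => [|e] //=; rewrite leqn0 size_poly_eq0 (negPf h0).
have [lu [lw [luu luw lwu lww]]] := dual_forms LE.
pose H : {mpoly K[3]} := \sum_(j < d.-1) h`_j *: (lin lu ^+ (d - 2 - j) * lin lw ^+ j).
have hH : H \is (d - 2).-homog.
  apply: rpred_sum => j _; apply: rpredZ.
  have jd : (j <= d - 2)%N by rewrite subn2; case: d j {hA sh H} => [|[|e]] [].
  have := dhomogM (dhomogMn (d - 2 - j) (lin_homog lu)) (dhomogMn j (lin_homog lw)).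
  by rewrite !mul1n subnK.
have H0 : (d < 2)%N -> H = 0.
  by move=> d2; rewrite /H big1 // => -[j jd]; move: (jd); case: d d2 {hA sh H hH jd} => [|[|e]].
have evH x y : (H.@[(x *: a + y *: w) 0]) =
    \sum_(j < d.-1) h`_j * (x ^+ (d - 2 - j) * y ^+ j).
  rewrite /H raddf_sum; apply: eq_bigr => j _ /=.
  rewrite mevalZ mevalM !rmorphXn /= !lin_comb luu luw lwu lww.
  by rewrite !mulr0 !mulr1 addr0 add0r.
pose B := A - (F : {mpoly K[3]}) * H.
have B0 x y : x != 0 -> B.@[(x *: a + y *: w) 0] = 0.
  move=> x0; rewrite /B mevalB mevalM evH.
  have -> : x *: a + y *: w = x *: (a + (y / x) *: w).
    by rewrite scalerDr scalerA mulrC divfK.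
  rewrite (meval_homog _ _ hF) (meval_homog _ _ hA) -!horner_form_restr -/p -/q qE hornerM.
  rewrite (horner_coef_wide _ sh); set s := \sum_(i < _) _; set s' := \sum_(i < _) _.
  suff e : x ^+ d.+1 * s = x ^+ 3 * s' by rewrite mulrA e; ring.
  rewrite {}/s {}/s'; case: d {hA vA sh H hH H0 evH B qE} => [|[|e]]; rewrite ?big_ord0 ?mulr0 //.
  rewrite subn2 /= -(add3n e) exprD -mulrA mulr_sumr; congr (_ * _).
  apply: eq_bigr => i _; rewrite mulrCA expr_div_n; congr (_ * _).
  by rewrite mulrCA mulrC -expfB_cond // (negPf x0) add0n -ltnS.
(* For d < 2 the restriction of A has degree below three, so h and H vanish. *)
have hB : B \is d.+1.-homog.
  apply: rpredB => //; have [d2|d2] := ltnP d 2; first by rewrite H0 // mulr0 rpred0.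
  have dE : d.+1 = (3 + (d - 2))%N.
    by case: (d) d2 => [|[|e]] // _; rewrite subn2.
  by rewrite dE; apply: dhomogM.
have [A' BE] : exists A', B = lin l * A'.
  apply: lin_dvd => // v /eqP; rewrite -lL => /(line_comb LE)[x [y ->]].
  have [->|] := eqVneq x 0; last exact: B0.
  (* The points x a + y w of the plane with x <> 0 are dense in it. *)
  have e : form_restr B (y *: w) a = 0.
    apply: (@poly_fun_eq0 _ _ [:: 0]) => t; rewrite inE => t0.
    by rewrite horner_form_restr addrC B0.
  by rewrite scale0r add0r -(horner_form_restr0 B _ a) e horner0.
exists A', H; split=> //.
- by rewrite -BE /B subrK.
- by apply: (homog_lin_quot l0); rewrite -BE.
move=> X u v c g br; set n := count_mem X D; set k := count_mem X [:: P; Q; S].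
have kp : (k.+1 <= arc_prec)%N by apply: leq_ltn_trans (c3 X) _.
have [r lE r0] : exists2 r, mmap polyC (arc u v c g) (lin l) = r * 'X^k & r.[0] != 0.
  have kE j : (j <= arc_prec)%N -> ('X^j %| mmap polyC (arc u v c g) (lin l)) = (j <= k)%N.
    move=> jp; have [XL|XL] := boolP (X <= L)%VS.
      by rewrite (lin_arc_order nolineF br hL) // cnt.
    have k0 : k = 0%N.
      apply/count_memPn; apply: contra XL; rewrite !inE.
      by move=> /or3P[] /eqP ->.
    rewrite k0 leqn0; case: j {jp} => [|j]; first by rewrite expr0 dvd1p.
    apply/negP => /(dvdp_trans (dvdp_exp2l 'X (isT : 0 < j.+1)%N)).
    by rewrite expr1 dvdX (horner_arc0 _ _ _ _ (br_g0 br)) -lL memvE -(br_pt br) (negPf XL).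
  have /dvdpP[r lE] : 'X^k %| mmap polyC (arc u v c g) (lin l) by rewrite kE // ltnW.
  exists r => //; apply/negP; rewrite -dvdX => /dvdpP[r' r'E].
  by have := kE k.+1 kp; rewrite ltnn lE r'E -mulrA -exprS dvdp_mull.
(* 9 + 3 = 12: no order in play exceeds the precision of the arc. *)
have nk : (n + k <= arc_prec)%N.
  rewrite (leq_trans (leq_add (count_size _ _) (c3 X))) //.
  by rewrite (leq_trans (leq_add sD (leqnn 3))).
have : 'X^(n + k) %| mmap polyC (arc u v c g) A.
  by have := vA _ _ _ _ _ br; rewrite -[[:: P, Q, S & D]]/([:: P; Q; S] ++ D) count_cat addnC.
have -> : A = lin l * A' + (F : {mpoly K[3]}) * H by rewrite -BE /B subrK.
rewrite rmorphD !rmorphM /= dvdp_addl; last first.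
  by rewrite dvdp_mulr // (dvdp_trans _ (br_curve br)) // dvdp_exp2l.
rewrite lE mulrAC exprD dvdp_mul2r ?expf_neq0 ?polyX_eq0 //.
by rewrite mulrC dvdXn_unit.
Qed.

End Noether.

(** * The norm of a polynomial modulo a monic cubic polynomial *)

Section Companion.
Variable R : comNzRingType.
Implicit Types (P Q : {poly R}).

(** Multiplication by y in the basis 1, y, y^2 of R[y]/(P), for a monic P of degree
    three; only the three low coefficients of P enter. *)
Definition companion3 P : 'M[R]_3 := companionmx [:: P`_0; P`_1; P`_2; 1].

(** The norm of Q from R[y]/(P) to R, that is the resultant of P and Q. *)
Definition fiber_norm P Q : R := \det (horner_mx (companion3 P) Q).

Lemma ord3P (T : 'I_3 -> Prop) : T ord0 -> T (lift ord0 ord0) -> T ord_max -> forall i, T i.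
Proof.
move=> T0 T1 T2 [[|[|[|//]]] lti].
- by rewrite (_ : Ordinal lti = ord0) //; apply: val_inj.
- by rewrite (_ : Ordinal lti = lift ord0 ord0) //; apply: val_inj.
- by rewrite (_ : Ordinal lti = ord_max) //; apply: val_inj.
Qed.

Lemma sum3 (V : nmodType) (f : 'I_3 -> V) :
  \sum_i f i = f ord0 + f (lift ord0 ord0) + f ord_max.
Proof.
rewrite !big_ord_recl big_ord0 addr0 addrA; congr (_ + _ + _).
by congr f; apply: val_inj.
Qed.

Lemma poly_size4E Q : (size Q <= 4)%N ->
  Q = (Q`_0)%:P + Q`_1 *: 'X + Q`_2 *: 'X^2 + Q`_3 *: 'X^3.
Proof.
move=> sQ; apply/polyP => i; rewrite !coefD coefC !coefZ coefX !coefXn.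
case: i => [|[|[|[|i]]]]; rewrite /= !(mulr0, mulr1, addr0, add0r) //.
by rewrite nth_default // (leq_trans sQ).
Qed.

Lemma row_companion0 P :
  delta_mx 0 (ord0 : 'I_3) *m companion3 P = delta_mx 0 (lift ord0 ord0) :> 'rV_3.
Proof.
rewrite -rowE; apply/rowP; apply: ord3P; by rewrite !mxE.
Qed.

Lemma row_companion1 P : delta_mx 0 (lift ord0 ord0) *m companion3 P = delta_mx 0 ord_max :> 'rV_3.
Proof.
rewrite -rowE; apply/rowP; apply: ord3P; by rewrite !mxE.
Qed.

Lemma row_companion2 P : delta_mx 0 ord_max *m companion3 P = \row_(i < 3) - P`_i.
Proof.
rewrite -rowE; apply/rowP; apply: ord3P; by rewrite !mxE.
Qed.

(** The first row of Q(C) lists the coordinates of Q modulo P. *)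
Lemma row0_horner_companion P Q : (size Q <= 3)%N ->
  (delta_mx 0 ord0 : 'rV[R]_3) *m horner_mx (companion3 P) Q = \row_(i < 3) Q`_i.
Proof.
move=> sQ; rewrite [in LHS](poly_size4E (leqW sQ)) [Q`_3]nth_default // scale0r addr0.
rewrite !rmorphD /= !linearZ /= rmorphXn /= horner_mx_C horner_mx_X.
rewrite expr2 !mulmxDr mul_mx_scalar -!scalemxAr mulmxA !row_companion0 row_companion1.
by apply/rowP; apply: ord3P; rewrite !mxE /= !(mulr1, mulr0, addr0, add0r).
Qed.

Lemma companion3_root P : P \is monic -> size P = 4%N -> horner_mx (companion3 P) P = 0.
Proof.
move=> mP sP; have P3 : P`_3 = 1 by have /monicP := mP; rewrite /lead_coef sP.
set C := companion3 P; set M := horner_mx C P.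
have CM : C *m M = M *m C by apply: comm_mx_horner.
have r0 : (delta_mx 0 ord0 : 'rV[R]_3) *m M = 0.
  rewrite /M [in horner_mx _ _](@poly_size4E P) ?sP // P3 scale1r.
  rewrite !rmorphD /= !linearZ /= !rmorphXn /= horner_mx_C horner_mx_X.
  rewrite (exprSr _ 2) !expr2 !mulmxDr mul_mx_scalar -!scalemxAr !mulmxA.
  rewrite !row_companion0 !row_companion1 row_companion2.
  by apply/rowP; apply: ord3P; rewrite !mxE /= !(mulr1, mulr0, addr0, add0r) subrr.
have r1 : (delta_mx 0 (lift ord0 ord0) : 'rV[R]_3) *m M = 0.
  by rewrite -(row_companion0 P) -mulmxA CM mulmxA r0 mul0mx.
have r2 : (delta_mx 0 ord_max : 'rV[R]_3) *m M = 0.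
  by rewrite -(row_companion1 P) -mulmxA CM mulmxA r1 mul0mx.
by apply/row_matrixP; apply: ord3P; rewrite rowE ?r0 ?r1 ?r2 row0.
Qed.

(** If g is a root of P modulo N, the powers of g form an eigenvector of the
    companion matrix modulo N, and Q takes the eigenvalue Q(g) on it. *)
Lemma companion3_eigen P Q (g N : R) : P \is monic -> size P = 4%N ->
  (exists r, P.[g] = N * r) -> exists r : 'cV_3,
  horner_mx (companion3 P) Q *m (\col_(i < 3) g ^+ i) = Q.[g] *: (\col_(i < 3) g ^+ i) + N *: r.
Proof.
move=> mP sP [z Pg]; set e := \col_i _.
have P3 : P`_3 = 1 by have /monicP := mP; rewrite /lead_coef sP.
have Ce : exists r : 'cV_3, companion3 P *m e = g *: e + N *: r.
  exists (- z *: delta_mx ord_max 0); apply/colP.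
  have row2 i : (companion3 P *m e) i 0 = ((delta_mx 0 i : 'rV_3) *m companion3 P *m e) 0 0.
    by rewrite -rowE -row_mul [RHS]mxE.
  apply: ord3P; rewrite row2 ?row_companion0 ?row_companion1 ?row_companion2 -?rowE !mxE ?sum3.
  - by rewrite !(mulr0, addr0) expr0 expr1 mulr1.
  - by rewrite !(mulr0, addr0) -exprS.
  have := Pg; rewrite [in P.[g]](@poly_size4E P) ?sP // P3 scale1r.
  rewrite !hornerD !hornerZ !hornerXn hornerC hornerX => h.
  rewrite !mxE /= -[bump 0 0]/1%N; transitivity (g * g ^+ 2 - N * z); [rewrite -h|]; ring.
have [r0 e0] := Ce.
elim/poly_ind: Q => [|Q c [r e1]].
  by exists 0; rewrite rmorph0 mul0mx horner0 scale0r scaler0 addr0.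
exists (Q.[g] *: r0 + companion3 P *m r).
rewrite rmorphD rmorphM /= horner_mx_X horner_mx_C mulmxDl.
have -> : horner_mx (companion3 P) Q * companion3 P = companion3 P *m horner_mx (companion3 P) Q.
  by apply/esym/comm_mx_horner.
rewrite -mulmxA e1 mulmxDr -!scalemxAr e0 mul_scalar_mx hornerMXaddC.
rewrite !scalerDr !scalerDl !scalerA [N * _]mulrC -!addrA.
by congr (_ + _); rewrite addrA [RHS]addrC.
Qed.

End Companion.

Section Resultant.
Variable R : comNzRingType.
Implicit Types (P Q : {poly R}).

(** The matrix Q(C) with its first column replaced by x. *)
Definition companion3_col0 P Q (x : 'cV[R]_3) : 'M[R]_3 :=
  \matrix_(i, j) if j == ord0 then x i 0 else horner_mx (companion3 P) Q i j.

Lemma det_companion3_col0 P Q a b x y : \det (companion3_col0 P Q (a *: x + b *: y)) =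
  a * \det (companion3_col0 P Q x) + b * \det (companion3_col0 P Q y).
Proof.
rewrite -[LHS]det_tr -[X in a * X]det_tr -[X in b * X]det_tr.
apply: (@determinant_multilinear _ _ _ _ _ ord0).
- by apply/rowP => j; rewrite !mxE.
- by apply/matrixP => i j; rewrite !mxE.
- by apply/matrixP => i j; rewrite !mxE.
Qed.

(** The powers of g start with 1, so they may replace the first basis vector
    without changing the determinant. *)
Lemma fiber_norm_col0 P Q g : fiber_norm P Q =
  \det (companion3_col0 P Q (horner_mx (companion3 P) Q *m (\col_(i < 3) g ^+ i))).
Proof.
(* Multiplying by the unipotent matrix U on the right replaces the first column. *)
pose U : 'M[R]_3 := \matrix_(i, j) if j == ord0 then g ^+ i else (i == j)%:R.
have dU : \det U = 1.
  rewrite det_trig; first by rewrite big1 // => i _; rewrite mxE eqxx; case: eqP => // ->.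
  apply/is_trig_mxP => i j ij; rewrite mxE -val_eqE /= (gtn_eqF (leq_ltn_trans _ ij)) //.
  by rewrite -val_eqE (ltn_eqF ij).
rewrite -[LHS]mulr1 -dU -det_mulmx; congr (\det _); apply/matrixP => i j.
rewrite mxE [RHS]mxE; case: (j =P ord0) => [->|/eqP j0].
  by rewrite mxE; apply: eq_bigr => k _; rewrite !mxE.
rewrite (bigD1 j) //= big1 => [|k kj].
  by rewrite !mxE (negPf j0) eqxx mulr1 addr0.
by rewrite !mxE (negPf j0) (negPf kj) mulr0.
Qed.

(** A root g of P modulo N splits the factor Q(g) off the norm modulo N.  The
    cofactor stands for the product of the values of Q at the other roots. *)
Lemma fiber_norm_eval P Q g N : P \is monic -> size P = 4%N ->
  (exists r, P.[g] = N * r) -> exists W, fiber_norm P Q =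
   Q.[g] * \det (companion3_col0 P Q (\col_(i < 3) g ^+ i)) + N * W.
Proof.
move=> mP sP PN; have [r e] := companion3_eigen Q mP sP PN.
by exists (\det (companion3_col0 P Q r)); rewrite (fiber_norm_col0 P Q g) e det_companion3_col0.
Qed.

End Resultant.

Section ResultantField.
Variable K : closedFieldType.
Implicit Types (P Q : {poly K}).

(** If P and Q were coprime, a Bezout relation would make Q invertible modulo
    P. *)
Lemma fiber_norm_eq0 P Q : P \is monic -> size P = 4%N -> fiber_norm P Q = 0 ->
  exists y, P.[y] = 0 /\ Q.[y] = 0.
Proof.
move=> mP sP n0; have : ~~ coprimep P Q.
  apply/negP => /Bezout_eq1_coprimepP[[a b] /= e].
  have /(congr1 determinant) : horner_mx (companion3 P) b *m horner_mx (companion3 P) Q = 1%:M.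
    have := congr1 (horner_mx (companion3 P)) e.
    by rewrite rmorphD !rmorphM /= companion3_root // mulr0 add0r rmorph1.
  by rewrite det_mulmx -/(fiber_norm P Q) n0 mulr0 det1 => /esym/eqP; rewrite oner_eq0.
rewrite coprimep_def => /closed_rootP[y]; rewrite root_gcd => /andP[].
by rewrite !rootE => /eqP ? /eqP ?; exists y.
Qed.

Lemma companion3_cyclic P Q : P \is monic -> size P = 4%N ->
  (delta_mx 0 ord0 : 'rV[K]_3) *m horner_mx (companion3 P) Q = 0 -> P %| Q.
Proof.
move=> mP sP; rewrite {1}(divp_eq Q P) rmorphD rmorphM /= companion3_root // mulr0 add0r.
have s3 : (size (Q %% P)%R <= 3)%N.
  by rewrite -ltnS -sP ltn_modp -size_poly_eq0 sP.
rewrite row0_horner_companion // => e; apply/modp_eq0P/polyP => i; rewrite coef0.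
have [i3|i3] := ltnP i 3; last by rewrite nth_default // (leq_trans s3).
by have := congr1 (fun A : 'rV_3 => A 0 (Ordinal i3)) e; rewrite !mxE.
Qed.

(** The cofactor of a simple root 0 of P is not zero when Q has no other root in
    common with P.  A row z in the kernel has first entry 0 and kills Q(C); as a
    polynomial of degree at most two it is X T with P dividing X T Q, hence
    P / X, which is coprime to Q, divides T, and T is of degree at most one. *)
Lemma cofactor_neq0 P Q (S : {poly K}) : P \is monic -> size P = 4%N -> P = 'X * S ->
  S.[0] != 0 -> Q.[0] = 0 -> (forall y, P.[y] = 0 -> Q.[y] = 0 -> y = 0) ->
  \det (companion3_col0 P Q (\col_(i < 3) 0 ^+ i)) != 0.
Proof.
move=> mP sP PE S0 Q0 PQ; apply/det0P => -[z z0 e].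
have z00 : z 0 ord0 = 0.
  have := congr1 (fun A : 'rV_3 => A 0 ord0) e.
  by rewrite !mxE sum3 !mxE /= !expr0n /= !(mulr0, addr0) mulr1.
set M := horner_mx (companion3 P) Q.
have Me : M *m (\col_(i < 3) 0 ^+ i) = 0.
  have [|r ->] := @companion3_eigen _ P Q 0 0 mP sP; last by rewrite Q0 !scale0r addr0.
  by exists 0; rewrite PE hornerM hornerX !mul0r.
have zM : z *m M = 0.
  apply/rowP => j; rewrite [RHS]mxE; have [->|j0] := eqVneq j ord0.
    have := congr1 (fun A : 'cV_3 => (z *m A) 0 0) Me; rewrite mulmxA mulmx0 [RHS]mxE mxE sum3.
    by rewrite ![(\col_i _) _ _]mxE !expr0n /= !(mulr0, addr0) mulr1.
  have := congr1 (fun A : 'rV_3 => A 0 j) e; rewrite [RHS]mxE => h.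
  apply: etrans h; rewrite !mxE; apply: eq_bigr => k _.
  by rewrite [companion3_col0 _ _ _ _ _]mxE (negPf j0).
pose T : {poly K} := (z 0 (lift ord0 ord0))%:P + z 0 ord_max *: 'X.
pose Z : {poly K} := 'X * T.
have sZ : (size T <= 2)%N.
  rewrite (leq_trans (size_polyD _ _)) // geq_max (leq_trans (size_polyC_leq1 _)) //=.
  by rewrite (leq_trans (size_scale_leq _ _)) // size_polyX.
have sZ3 : (size Z <= 3)%N.
  by rewrite (leq_trans (size_polyMleq _ _)) // size_polyX /= !ltnS.
have zE : z = (delta_mx 0 ord0 : 'rV[K]_3) *m horner_mx (companion3 P) Z.
  rewrite row0_horner_companion //; apply/rowP; apply: ord3P;
    rewrite !mxE coefXM /T //= coefD coefC coefZ coefX /=.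
    by rewrite mulr0 addr0.
  by rewrite mulr1 add0r.
have : P %| Z * Q.
  by apply: companion3_cyclic => //; rewrite rmorphM /= mulmxA -zE.
rewrite PE /Z -mulrA dvdp_mul2l ?polyX_eq0 // Gauss_dvdpl; last first.
  rewrite coprimep_def; apply/negPn/negP => /closed_rootP[y].
  rewrite root_gcd !rootE => /andP[/eqP Sy /eqP Qy].
  have y0 : y = 0 by apply: PQ => //; rewrite PE hornerM Sy mulr0.
  by move: S0; rewrite -{1}y0 Sy eqxx.
have sS : size S = 3%N.
  have Sn0 : S != 0 by apply: contraNneq S0 => ->; rewrite horner0.
  by move: sP; rewrite PE mulrC size_mulX // => -[].
move=> /dvdp_leq h; move: z0; apply/negP; rewrite negbK.
have : T == 0.
  by apply: contraT => /h; rewrite sS leqNgt ltnS sZ.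
move=> /eqP Z0; rewrite zE /Z Z0 mulr0 rmorph0 mulmx0 eqxx //.
Qed.

End ResultantField.

(** * The norm along the lines through a point *)

Section NormMaps.

Lemma map_companion3 (R S : comNzRingType) (f : {rmorphism R -> S}) (P : {poly R}) :
  map_mx f (companion3 P) = companion3 (map_poly f P).
Proof.
apply/matrixP => i; apply: ord3P; rewrite !mxE /=;
  by case: ifP; rewrite ?rmorphN ?rmorph_nat ?coef_map.
Qed.

Lemma map_companion3_col0 (R S : comNzRingType) (f : {rmorphism R -> S}) (P Q : {poly R}) x :
  map_mx f (companion3_col0 P Q x) = companion3_col0 (map_poly f P) (map_poly f Q) (map_mx f x).
Proof.
apply/matrixP => i j; rewrite !mxE -map_companion3 -map_horner_mx.
by case: ifP => // _; rewrite mxE.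
Qed.

Lemma fiber_norm_map (R S : comNzRingType) (f : {rmorphism R -> S}) (P Q : {poly R}) :
  f (fiber_norm P Q) = fiber_norm (map_poly f P) (map_poly f Q).
Proof.
by rewrite /fiber_norm -det_map_mx map_horner_mx map_companion3.
Qed.

Variable K : closedFieldType.
Implicit Types (A : {mpoly K[3]}) (b c u v : 'rV[K]_3) (P Q : {poly K}).

Lemma coef_form_restr_scale d A b c (s : K) k : A \is d.-homog -> s != 0 -> (k <= d)%N ->
  (form_restr A (s *: b) c)`_k = s ^+ (d - k) * (form_restr A b c)`_k.
Proof.
move=> hA s0 kd; have e t : (form_restr A (s *: b) c).[t] = s ^+ d * (form_restr A b c).[t / s].
  rewrite !horner_form_restr -(meval_homog _ _ hA); congr (_.@[_ 0]).
  by rewrite scalerDr scalerA mulrC divfK.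
have -> : form_restr A (s *: b) c = \poly_(j < d.+1) (s ^+ (d - j) * (form_restr A b c)`_j).
  apply: (@poly_fun_inj _ _ _ [::]) => t _; rewrite e horner_poly.
  rewrite (horner_coef_wide _ (size_form_restr b c hA)) mulr_sumr; apply: eq_bigr => j _.
  have -> : s ^+ d = s ^+ (d - j) * s ^+ j by rewrite -exprD subnK // -ltnS.
  have := expf_neq0 j s0; rewrite expr_div_n.
  set x := s ^+ j; set y := t ^+ j; set z := s ^+ _ => x0; by field.
by rewrite coef_poly ltnS kd.
Qed.

Lemma horner_mx_size4 (C : 'M[K]_3) Q : (size Q <= 4)%N ->
  horner_mx C Q = \sum_(k < 4) Q`_k *: C ^+ k.
Proof.
move=> sQ; rewrite {1}(poly_size4E sQ) !rmorphD /= !linearZ /= !rmorphXn /= horner_mx_C horner_mx_X.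
by rewrite !big_ord_recl big_ord0 addr0 !addrA expr0 expr1 scalemx1.
Qed.

(** Scaling the roots of P by s and Q by s^3 conjugates the companion matrix by
    diag(1, s, s^2), up to the factor s.  The exponent is 9 = 3 * 3. *)
Lemma fiber_norm_scale P P' Q Q' (s : K) : s != 0 ->
  (size Q <= 4)%N -> (size Q' <= 4)%N ->
  (forall k, (k < 3)%N -> P'`_k = s ^+ (3 - k) * P`_k) ->
  (forall k, (k < 4)%N -> Q'`_k = s ^+ (3 - k) * Q`_k) ->
  fiber_norm P' Q' = s ^+ 9 * fiber_norm P Q.
Proof.
move=> s0 sQ sQ' eP eQ; pose D : 'M[K]_3 := diag_mx (\row_(i < 3) s ^+ i).
have CD : companion3 P' *m D = s *: (D *m companion3 P).
  apply/matrixP => i j; rewrite mul_mx_diag mul_diag_mx !mxE.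
  move: i j; apply: ord3P; apply: ord3P; rewrite /= ?(mulr0, mul0r, mulr1, mul1r, expr0, expr1) //;
   rewrite eP // ?subSS subn0; ring.
have CkD k : companion3 P' ^+ k *m D = s ^+ k *: (D *m companion3 P ^+ k).
  elim: k => [|k IH]; first by rewrite !expr0 scale1r mul1mx mulmx1.
  rewrite exprSr -mulmxA CD -scalemxAr mulmxA IH -scalemxAl scalerA -exprS -mulmxA.
  by rewrite [companion3 P ^+ k.+1]exprSr.
have MD : horner_mx (companion3 P') Q' *m D = s ^+ 3 *: (D *m horner_mx (companion3 P) Q).
  rewrite !horner_mx_size4 // mulmx_suml mulmx_sumr scaler_sumr; apply: eq_bigr => k _.
  rewrite -scalemxAl CkD -scalemxAr !scalerA eQ // mulrAC -exprD subnK //.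
  by rewrite -ltnS.
have dD : \det D != 0.
  by rewrite det_diag; apply/prodf_neq0 => i _; rewrite mxE expf_neq0.
apply: (mulIf dD); rewrite -det_mulmx MD detZ det_mulmx -exprM; rewrite /fiber_norm; ring.
Qed.

(** The polynomial A(u + x v + y c) in y, with coefficients in K[x]: the
    restrictions of A to the lines joining c to the points of the line
    <u, v>. *)
Definition pencil_fiber A u v c : {poly {poly K}} :=
  mmap (polyC \o polyC) (fun i => ((u 0 i)%:P + v 0 i *: 'X)%:P + (c 0 i)%:P *: 'X) A.

Lemma pencil_fiber_at A u v c x :
  map_poly (horner_eval x) (pencil_fiber A u v c) = form_restr A (u + x *: v) c.
Proof.
rewrite /pencil_fiber (@mmap_comp _ _ _ (polyC \o polyC) polyC (map_poly (horner_eval x))).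
  apply: mmap_ext => i /=; rewrite rmorphD /= map_polyC map_polyZ map_polyX /= /horner_eval.
  by rewrite !hornerE !mxE [x * _]mulrC.
by move=> k /=; rewrite map_polyC /= /horner_eval hornerC.
Qed.

Lemma horner_pencil_fiber A u v c g :
  (pencil_fiber A u v c).[g] = mmap polyC (arc u v c g) A.
Proof.
rewrite -[LHS]/(horner_eval g _) /pencil_fiber.
rewrite (@mmap_comp _ _ _ (polyC \o polyC) polyC (horner_eval g)).
  apply: mmap_ext => i /=; rewrite /horner_eval !hornerE; by rewrite /arc mulrC.
by move=> k /=; rewrite /horner_eval hornerC.
Qed.

Lemma coef_pencil_fiber A u v c k x :
  ((pencil_fiber A u v c)`_k).[x] = (form_restr A (u + x *: v) c)`_k.
Proof. by rewrite -pencil_fiber_at coef_map. Qed.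

Lemma size_pencil_fiber A d u v c : A \is d.-homog -> (size (pencil_fiber A u v c) <= d.+1)%N.
Proof.
move=> hA; apply/leq_sizeP => j dj; apply: (@poly_fun_eq0 _ _ [::]) => x _.
by rewrite coef_pencil_fiber nth_default // (leq_trans (size_form_restr _ _ hA)).
Qed.

Lemma lead_pencil_fiber A d u v c : A \is d.-homog -> (pencil_fiber A u v c)`_d = (A.@[c 0])%:P.
Proof.
move=> hA; apply: (@poly_fun_inj _ _ _ [::]) => x _.
by rewrite coef_pencil_fiber (lead_form_restr _ _ hA) hornerC.
Qed.

Lemma monic_size4 (R : nzRingType) (P : {poly R}) : (size P <= 4)%N -> P`_3 = 1 ->
  P \is monic /\ size P = 4%N.
Proof.
move=> s4 P3; have s : size P = 4%N.
  apply/eqP; rewrite eqn_leq s4 /= ltnNge; apply/negP => /leq_sizeP/(_ 3%N (leqnn _)).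
  by rewrite P3 => /eqP; rewrite oner_eq0.
by split=> //; rewrite monicE lead_coefE s P3.
Qed.

End NormMaps.

(** * Contact of order nine at the only common point *)

Section Contact.
Variable K : closedFieldType.
Implicit Types (a b c u v w : 'rV[K]_3) (P : point K).
Variable F : cubic K.

Lemma branch_free X u v c g x y z : branch F X u v c g ->
  x *: u + y *: v + z *: c = 0 -> [/\ x = 0, y = 0 & z = 0].
Proof.
move=> br e; have fr : free [:: u; v; c].
  rewrite /free; suff -> : <<[:: u; v; c]>>%VS = fullv by rewrite dimvf /dim /= mul1n.
  apply/vspaceP => w; rewrite memvf; have [x' [y' [z' ->]]] := br_span br w.
  by rewrite !memvD // memvZ // memv_span // !inE eqxx ?orbT.
move/freeP: fr => fr.
have h : forall i : 'I_3, [:: x; y; z]`_i = 0.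
  by apply: (fr (fun i : 'I_3 => [:: x; y; z]`_i)); rewrite sum3.
by split; [exact: (h ord0) | exact: (h (lift ord0 ord0)) | exact: (h ord_max)].
Qed.

(** Let N(b) be the norm of G on the line joining b to c.  It is homogeneous of
    degree nine in b, and N(x u + y v) = 0 forces y = 0, because a common point
    of F and G on that line is p = <u>.  So n(x) = N(u + x v) is a constant times
    x^9.  Modulo a high power of x it is also the value of G on the arc times a
    cofactor that is invertible at x = 0, because the line joining c to p carries
    no other common point. *)
Lemma contact_nine (G : cubic K) p :
  on_curve G p -> (forall X, on_curve F X -> on_curve G X -> X = p) ->
  vanishes F G (nseq 9 p).
Proof.
move=> Gp FG X u v c g br; have hF := dhomog_is_dhomog F; have hG := dhomog_is_dhomog G.
rewrite count_nseq /=; case: eqP => [e|_]; last by rewrite expr0 dvd1p.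
subst X; rewrite mul1n.
have Gu : (G : {mpoly K[3]}).@[u 0] = 0 by apply/(on_curveE _ (br_pt br)).
have Fu := branch_on br.
have mon a b : pencil_fiber F a b c \is monic /\ size (pencil_fiber F a b c) = 4%N.
  apply: monic_size4; rewrite ?(size_pencil_fiber _ _ _ hF) //.
  by rewrite (lead_pencil_fiber _ _ _ hF) (br_monic br).
have mon0 b : form_restr F b c \is monic /\ size (form_restr F b c) = 4%N.
  apply: monic_size4; rewrite ?(size_form_restr _ _ hF) //.
  by rewrite (lead_form_restr _ _ hF) (br_monic br).
pose N b := fiber_norm (form_restr F b c) (form_restr G b c).
pose n := fiber_norm (pencil_fiber F u v c) (pencil_fiber G u v c).
pose m := fiber_norm (pencil_fiber F v u c) (pencil_fiber G v u c).
have nE x : n.[x] = N (u + x *: v).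
  by rewrite -[LHS]/(horner_eval x n) fiber_norm_map !pencil_fiber_at.
have mE x : m.[x] = N (v + x *: u).
  by rewrite -[LHS]/(horner_eval x m) fiber_norm_map !pencil_fiber_at.
have Ns (s : K) b : s != 0 -> N (s *: b) = s ^+ 9 * N b.
  move=> s0; apply: fiber_norm_scale => //; rewrite ?(size_form_restr _ _ hG) //.
    by move=> k k3; rewrite (coef_form_restr_scale _ _ hF) // ltnW.
  by move=> k k3; rewrite (coef_form_restr_scale _ _ hG).
have common x y z : (F : {mpoly K[3]}).@[(x *: u + y *: v + z *: c) 0] = 0 ->
    (G : {mpoly K[3]}).@[(x *: u + y *: v + z *: c) 0] = 0 -> y = 0 /\ z = 0.
  set w := _ + z *: c => Fw Gw; have [w0|w0] := eqVneq w 0.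
    by have [] := branch_free br w0.
  have := FG (point_of w0); rewrite !(@on_curveE _ _ (point_of w0) w) // => /(_ Fw Gw) e.
  have : w \in (p : {vspace _}) by rewrite -e memv_line.
  rewrite (br_pt br) => /vlineP[k wk].
  have [|] := branch_free (x := x - k) (y := y) (z := z) br; last by [].
  by rewrite scalerBl -wk (addrAC _ (- w)) (addrAC _ (- w)); apply: subrr.
have N0 x y : N (x *: u + y *: v) = 0 -> y = 0.
  move=> /(fiber_norm_eq0 (mon0 _).1 (mon0 _).2)[z []]; rewrite !horner_form_restr.
  by move=> Fw Gw; have [] := common _ _ _ Fw Gw.
(* The polynomial m is n in the other chart of the pencil of lines through c. *)
have n9 : 'X^9 %| n.
  have nm := reverse_coef (p := n) (q := m) (d := 9).
  have {}nm : forall i, n`_i = if (i <= 9)%N then m`_(9 - i) else 0.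
    apply: nm => t t0; rewrite nE mE -Ns //; congr N.
    by rewrite scalerDr scalerA mulfV // scale1r addrC.
  have m0 : n`_9 != 0.
    rewrite nm /= subnn -horner_coef0 mE scale0r addr0; apply/eqP => e.
    have := N0 0 1; rewrite scale0r add0r scale1r e => /(_ erefl)/eqP.
    by rewrite oner_eq0.
  have [s ns] := closed_field_poly_normal n.
  have n0 : n != 0 by apply: contraNneq m0 => ->; rewrite coef0.
  have s0 : s = nseq (size s) 0.
    apply/all_pred1P/allP => z zs /=; apply/eqP.
    apply: (N0 1 z); rewrite scale1r -nE; apply/eqP; rewrite -rootE ns.
    by rewrite rootZ ?lead_coef_eq0 // root_prod_XsubC.
  have nX : n = lead_coef n *: 'X^(size s).
    by rewrite {1}ns {1}s0 big_nseq iter_mulr_1 subr0.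
  move: m0; rewrite {1}nX coefZ coefXn.
  case: (9%N =P size s) => [e _|_]; last by rewrite mulr0 eqxx.
  by rewrite nX -e -mul_polyC dvdp_mull.
have [|W nW] := @fiber_norm_eval _ _ (pencil_fiber G u v c) g 'X^arc_prec (mon u v).1 (mon u v).2.
  by rewrite horner_pencil_fiber; have /dvdpP[r ->] := br_curve br; exists r; rewrite mulrC.
move: n9; rewrite /n nW horner_pencil_fiber dvdp_addl; last first.
  by rewrite dvdp_mulr // dvdp_exp2l.
rewrite dvdXn_unit // -[X in X != 0]/(horner_eval 0 _) -det_map_mx map_companion3_col0.
rewrite !pencil_fiber_at !scale0r !addr0.
have -> : map_mx (horner_eval 0) (\col_(i < 3) g ^+ i) = \col_(i < 3) (0 : K) ^+ i.
  by apply/colP => i; rewrite !mxE /horner_eval horner_exp (br_g0 br).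
have [E e] := form_restr_taylor F u c.
apply: (cofactor_neq0 (mon0 u).1 (mon0 u).2 (S := (dirderiv F u c)%:P + 'X * E)).
- by rewrite e Fu polyC0 add0r mulrDr mulrA expr2.
- by rewrite hornerD hornerC hornerM hornerX mul0r addr0 (br_transv br).
- by rewrite horner_form_restr0.
move=> y; rewrite !horner_form_restr => Fy Gy.
by have [] := @common 1 0 y; rewrite ?scale1r ?scale0r ?addr0.
Qed.

End Contact.

(** * Torsion of the base point *)

Section Torsion.
Variable K : closedFieldType.
Implicit Types (A B H : {mpoly K[3]}) (l u v w : 'rV[K]_3) (P Q S X o p : point K).
Implicit Types (L M T : line K).

Lemma homog0_const A : A \is 0.-homog -> A = (A@_0)%:MP.
Proof.
move=> hA; apply/mpolyP => m; rewrite mcoeffC; have [->|m0] := eqVneq m 0%MM.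
  by rewrite mulr1.
rewrite mulr0; apply: (dhomog_nemf_coeff hA).
by rewrite /= mdeg_eq0.
Qed.

Lemma unit_homog0 A : A \is a GRing.unit -> A \is 0.-homog.
Proof.
by case/andP => /eqP -> _; rewrite -[_%:MP]mulr1 mul_mpolyC dhomogZ // dhomog1.
Qed.

(** Degrees: neither a linear form nor its cofactor in a cubic is constant. *)
Lemma irreducible_not_line (F : cubic K) l A : irreducible_cubic F -> l != 0 ->
  (F : {mpoly K[3]}) <> lin l * A.
Proof.
move=> [F0 _ irr] l0 e; have hF := dhomog_is_dhomog F.
have [/unit_homog0 h|/unit_homog0 h] := irr _ _ e.
  by have := dhomog_uniq (lin_neq0 l0) h (lin_homog l).
have hE : (F : {mpoly K[3]}) \is 1.-homog by rewrite e; have := dhomogM (lin_homog l) h.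
by have := dhomog_uniq F0 hF hE.
Qed.

(** The quotient of two cubic forms has degree zero. *)
Lemma homog_dvd_const (F G : cubic K) H : (F : {mpoly K[3]}) != 0 ->
  (G : {mpoly K[3]}) = (F : {mpoly K[3]}) * H -> exists k, G = k *: F.
Proof.
move=> F0 e; have hF := dhomog_is_dhomog F; have hG := dhomog_is_dhomog G.
have [H0|H0] := eqVneq H 0.
  by exists 0; apply: val_inj; rewrite /= e H0 mulr0 scale0r.
have G0 : (G : {mpoly K[3]}) != 0 by rewrite e mulf_neq0.
have dF := dhomog_uniq F0 hF (dhomog_msize hF).
have dG := dhomog_uniq G0 hG (dhomog_msize hG).
have : msize H = 1%N.
  have {}dG : (3 = (msize (G : {mpoly K[3]})).-1)%N := dG.
  have {}dF : (3 = (msize (F : {mpoly K[3]})).-1)%N := dF.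
  move: dG; rewrite e msizeM // (mpolySpred _ F0) (mpolySpred _ H0) -dF.
  by rewrite addnS /= => -[]; case: (msize H).-1.
move=> s1; have HC : H = (H@_0)%:MP by apply: msize1_polyC; rewrite s1.
by exists (H@_0); apply: val_inj; rewrite /= e {1}HC mulrC mul_mpolyC.
Qed.

Section OneCubic.
Variable F : cubic K.
Hypothesis smoothF : smooth F.
Hypothesis nolineF : forall l A, l != 0 -> (F : {mpoly K[3]}) <> lin l * A.

Lemma vanishes_perm A D D' : perm_eq D D' -> vanishes F A D -> vanishes F A D'.
Proof. by move=> /permP e h X u v c g br; rewrite -e; apply: h br. Qed.

Lemma vanishesM A B D D' : vanishes F A D -> vanishes F B D' -> vanishes F (A * B) (D ++ D').
Proof.
move=> hA hB X u v c g br; rewrite count_cat exprD rmorphM /=.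
by rewrite dvdp_mul // ?(hA _ _ _ _ _ br) // (hB _ _ _ _ _ br).
Qed.

Lemma vanishes_line L l P Q S : line_eq L l -> line_section F L P Q S ->
  vanishes F (lin l) [:: P; Q; S].
Proof.
move=> hL [PL QL SL cnt] X u v c g br; have [XL|XL] := boolP (X <= L)%VS.
  rewrite (lin_arc_order nolineF br hL XL) ?cnt //.
  exact: leq_trans (count_size _ _) _.
suff -> : count_mem X [:: P; Q; S] = 0%N by rewrite expr0 dvd1p.
apply/count_memPn; apply: contra XL; rewrite !inE.
by move=> /or3P[] /eqP ->.
Qed.

(** With R the third point of the chord PQ, the line through o and R meets F in
    o + R + (P + Q), and the chord in P + Q + R. *)
Lemma chord_step o P Q A D : on_curve F o -> on_curve F P -> on_curve F Q ->
  A \is 3.-homog -> (forall H, A <> (F : {mpoly K[3]}) * H) -> (size D <= 7)%N ->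
  vanishes F A [:: P, Q & D] ->
  exists A', [/\ A' \is 3.-homog, forall H, A' <> (F : {mpoly K[3]}) * H &
    vanishes F A' [:: o, cadd F o P Q & D]].
Proof.
move=> oF PF QF hA nA sD vA.
have [L sL] := thirdP smoothF nolineF PF QF; have RF := third_on smoothF nolineF PF QF.
have [M sM] := thirdP smoothF nolineF oF RF.
rewrite -/(cadd F o P Q) in sM; set S := cadd F o P Q in sM *; set R := third F P Q in sL RF sM.
have [l hL] := exists_line_eq L; have [m hM] := exists_line_eq M.
have vAm : vanishes F (A * lin m) [:: P, Q, R & [:: o, S & D]].
  apply: vanishes_perm (vanishesM vA (vanishes_line hM sM)).
  apply/permP => a.
  rewrite /= ?count_cat /=.
  lia.
have hAm : A * lin m \is 4.-homog by have := dhomogM hA (lin_homog m).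
have [//|A' [H [e hA' _ _ vA']]] := noether_line smoothF nolineF hAm sL hL vAm.
exists A'; split=> // H' e'; have [m0 _] := hM.
have : (F : {mpoly K[3]}) * (lin l * H' + H) = lin m * A.
  by rewrite [RHS]mulrC e e'; ring.
case/(lin_prime m0) => [[B]|[B eB]]; first exact: nolineF.
apply: (nA B); apply: (mulfI (lin_neq0 m0)).
by rewrite mulrC e e' -[RHS]mulrCA -eB; ring.
Qed.

Lemma cmul_1 o p : on_curve F o -> on_curve F p -> cmul F o 1 p = p.
Proof.
move=> oF pF; have [L sL] := thirdP smoothF nolineF pF oF.
apply: (third_unique smoothF nolineF (L := L)).
apply: line_section_perm sL; apply/permP => a /=; rewrite ?count_cat /=; lia.
Qed.

Lemma chord_iter o p (G : {mpoly K[3]}) k : on_curve F o -> on_curve F p ->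
  G \is 3.-homog -> (forall H, G <> (F : {mpoly K[3]}) * H) ->
  vanishes F G (nseq 9 p) -> (k <= 8)%N ->
  exists A, [/\ A \is 3.-homog, forall H, A <> (F : {mpoly K[3]}) * H &
    vanishes F A (cmul F o k.+1 p :: nseq (8 - k) p ++ nseq k o)].
Proof.
move=> oF pF hG nG vG; elim: k => [_|k IH k8].
  by exists G; rewrite (cmul_1 oF pF) cats0; split.
have [A [hA nA vA]] := IH (ltnW k8).
have := @chord_step o p (cmul F o k.+1 p) A (nseq (8 - k.+1) p ++ nseq k o) oF pF.
case=> //.
- exact: cmul_on.
- by rewrite size_cat !size_nseq -ltnS -addSn -subSn // subSS subnK // ltnW.
- apply: vanishes_perm vA; rewrite -[(8 - k)%N]subSS subSn //=.
  by apply/permP => a /=; rewrite ?count_cat /=; lia.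
move=> A' [hA' nA' vA']; exists A'; split; [exact: hA' | exact: nA' |].
apply: vanishes_perm vA'; apply/permP => a /=; rewrite !count_cat /=; lia.
Qed.

(** The chord construction turns 9p into 8 o and the point 9p.  Removing the flex
    tangent twice leaves a nonzero linear form which meets F twice at o and at the
    point 9p, so its line is the tangent at o. *)
Lemma nine_torsion o p (G : {mpoly K[3]}) : flex F o -> on_curve F p ->
  G \is 3.-homog -> (forall H, G <> (F : {mpoly K[3]}) * H) ->
  vanishes F G (nseq 9 p) -> cmul F o 9 p = o.
Proof.
move=> flo pF hG nG vG; have [oF _] := flo.
have [T sT] := flex_section smoothF nolineF flo; have [t hT] := exists_line_eq T.
have [A [hA nA vA]] := chord_iter oF pF hG nG vG (leqnn 8).
have aF : on_curve F (cmul F o 9 p) by apply: cmul_on.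
set a := cmul F o 9 p in vA aF *.
have vA0 : vanishes F A [:: o, o, o, a & nseq 5 o].
  by apply: vanishes_perm vA; apply/permP => x /=; rewrite ?count_cat /=; lia.
have [//|A1 [H1 [e1 hA1 _ _ vA1]]] := noether_line smoothF nolineF hA sT hT vA0.
have vA1' : vanishes F A1 [:: o, o, o, a & nseq 2 o].
  by apply: vanishes_perm vA1; apply/permP => x /=; rewrite ?count_cat /=; lia.
have [//|A2 [H2 [e2 hA2 _ _ vA2]]] := noether_line smoothF nolineF hA1 sT hT vA1'.
have [n nE] := homog1_lin hA2.
have n0 : n != 0.
  apply/eqP => n0; apply: (nA (lin t * H2 + H1)).
  have l0 : lin n = 0 by rewrite n0 /lin big1 // => i _; rewrite mxE scale0r.
  by rewrite e1 e2 nE l0; ring.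
have hN := line_ofP n0; set N := line_of n0 in hN; have [_ inN] := hN.
have on X u v c g : branch F X u v c g -> X \in [:: a, o & [:: o]] -> (X <= N)%VS.
  move=> br Xin; rewrite (br_pt br) -memvE inN -nE -(horner_arc0 _ u v c (br_g0 br)) -dvdX.
  apply: dvdp_trans (vA2 _ _ _ _ _ br); rewrite -{1}['X]expr1 dvdp_exp2l //.
  by rewrite -has_count has_pred1.
have [u [v [c [g br]]]] := exists_branch smoothF oF.
have oN : (o <= N)%VS by apply: on br _; rewrite !inE eqxx !orbT.
have [oT _ _ cT] := sT.
(* Contact of order two at o singles out the tangent. *)
have NT : N = T.
  apply: line_inj; rewrite (tangent_line nolineF br oT).1 ?cT //= ?eqxx //.
  apply/(tangent_line nolineF br oN); rewrite -(lin_arc_order nolineF br hN) // -nE.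
  apply: dvdp_trans (vA2 _ _ _ _ _ br); rewrite dvdp_exp2l //= eqxx.
  by rewrite addn0 leq_addl.
have [u' [v' [c' [g' br']]]] := exists_branch smoothF aF.
have aN : (a <= N)%VS by apply: on br' _; rewrite inE eqxx.
move: aF => /(on_curve_int_mult nolineF aN); rewrite NT cT -?NT //.
by rewrite -has_count has_pred1 !inE !orbb => /eqP.
Qed.

(** If 3p = o, the chord from p to 2p ends in the point collinear with o and o,
    which is o since o is a flex.  The chord from o to 2p therefore ends in p; it
    also ends in the third point of the tangent at p. *)
Lemma three_torsion_flex o p : flex F o -> on_curve F p -> cmul F o 3 p = o ->
  exists L, line_section F L p p p.
Proof.
move=> flo pF e3; have [oF _] := flo.
have [T sT] := flex_section smoothF nolineF flo.
have tP := thirdP smoothF nolineF; have tO := third_on smoothF nolineF.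
have tU := third_unique smoothF nolineF.
set a := cmul F o 2 p.
have aF : on_curve F a by apply: cmul_on.
have [L1 s1] := tP _ _ pF aF; have bF := tO _ _ pF aF.
set b2 := third F p a in s1 bF.
have b2o : b2 = o.
  have [M1 m1] := tP _ _ oF bF; rewrite -/(cadd F o p a) in m1.
  have e3' : cadd F o p a = o by [].
  rewrite e3' in m1; have m1' : line_section F M1 o o b2.
    by apply: line_section_perm m1; apply/permP => x /=; rewrite ?count_cat /=; lia.
  by rewrite -(tU _ _ _ _ m1') (tU _ _ _ _ sT).
have aE : a = cadd F o p p by rewrite /a -[2%N]/(1.+1) /cmul iterS -/(cmul F o 1 p) cmul_1.
have [L0 s0] := tP _ _ pF pF; have cF := tO _ _ pF pF.
set b1 := third F p p in s0 cF.
have [M0 m0] := tP _ _ oF cF; rewrite -/(cadd F o p p) -aE in m0.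
have m0' : line_section F M0 o a b1.
  by apply: line_section_perm m0; apply/permP => x /=; rewrite ?count_cat /=; lia.
have s1' : line_section F L1 o a p.
  by apply: line_section_perm s1; apply/permP => x /=; rewrite b2o; lia.
exists L0; move: s0; rewrite -[b1](tU _ _ _ _ m0') (tU _ _ _ _ s1') => s0.
exact: s0.
Qed.

(** A cubic containing a line section of F agrees with a multiple of F on that
    line. *)
Lemma cubic_through_section p L l (G : {mpoly K[3]}) : line_section F L p p p -> line_eq L l ->
  G \is 3.-homog -> vanishes F G (nseq 9 p) ->
  exists A k, G = lin l * A + k *: (F : {mpoly K[3]}).
Proof.
move=> sL hL hG vG.
have [//|A [H [-> _ hH _ _]]] := noether_line smoothF nolineF hG sL hL vG.
by exists A, (H@_0); rewrite {1}(homog0_const hH) [X in _ + X = _]mulrC mul_mpolyC.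
Qed.

End OneCubic.

Lemma pencil_span (V : {vspace cubic K}) (F : cubic K) : \dim V = 2%N -> member V F ->
  exists G : cubic K, [/\ member V G, forall k, G <> k *: F &
    forall E, E \in V -> exists x y, E = x *: F + y *: G].
Proof.
move=> dV [FV F0]; have : ~~ (V <= <[F]>)%VS.
  by apply/negP => /dimvS; rewrite dV dim_vline; case: (F != 0).
case/subvPn => G GV GF.
have GF' k : G <> k *: F by move=> e; case/vlineP: GF; exists k.
exists G; split=> //.
  by split=> //; apply: contraNneq GF => ->; apply: mem0v.
move=> E EV; suff VE : V = (<[F]> + <[G]>)%VS.
  by move: EV; rewrite VE => /memv_addP[_ /vlineP[x ->]] [_ /vlineP[y ->] ->]; exists x, y.
apply/esym/eqP; rewrite eqEdim subv_add -!memvE FV GV dV /=.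
rewrite ltnNge; apply: contra GF => d1.
suff -> : <[F]>%VS = (<[F]> + <[G]>)%VS by rewrite memvE addvSr.
apply/eqP; rewrite eqEdim addvSl dim_vline (_ : F != 0) //.
Qed.

(** If G - k F contained a line it would be a reducible member of the pencil. *)
Theorem pencil_base_point (V : {vspace cubic K}) (p : point K) (F : cubic K) (o : point K) :
  \dim V = 2%N -> single_base_point V -> members_irreducible V -> base_point V p ->
  member V F -> smooth F -> flex F o -> torsion F o 9 p /\ ~ torsion F o 3 p.
Proof.
move=> dV [p' [_ uniq]] irr bp hF smoothF flo.
have [G [hG GF spanV]] := pencil_span dV hF.
have nolineF l A := @irreducible_not_line F l A (irr F hF).
have pF := bp F hF; have pG := bp G hG.
have FG X : on_curve F X -> on_curve G X -> X = p.
  move=> XF XG; rewrite -(uniq p bp); apply/esym/uniq => E [EV _].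
  have [x [y ->]] := spanV E EV => v vX.
  by rewrite /= mevalD !mevalZ XF // XG // !mulr0 addr0.
have vG := contact_nine pG FG.
have gG := dhomog_is_dhomog G.
split; first split=> //.
  apply: (nine_torsion smoothF nolineF flo pF gG _ vG) => H.
  by case: (irr F hF) => F0 _ _ /(homog_dvd_const F0)[k /GF].
move=> [_ p3]; have [L sL] := three_torsion_flex smoothF nolineF flo pF p3.
have [l hL] := exists_line_eq L.
have [A [k e]] := cubic_through_section smoothF nolineF sL hL gG vG.
have hE : member V (G - k *: F).
  case: hF hG => FV _ [GV _]; split; first by rewrite rpredB ?rpredZ.
  by apply/eqP => /subr0_eq /GF.
apply: (irreducible_not_line (irr _ hE) _ (A := A)); first by case: hL => l0 _; exact: l0.
by rewrite /= e addrK.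
Qed.

End Torsion.

Theorem proposition3p2 (R : realType) (V : {vspace cubic R[i]})
    (p : point R[i]) (dimV : \dim V = 2%N)
    (hC1 : single_base_point V) (hC2 : general_member_smooth V)
    (hC3 : members_irreducible V) (hp : base_point V p)
    (F : cubic R[i]) (hF : member V F) (smoothF : smooth F)
    (o : point R[i]) (flexo : flex F o) :
  torsion F o 9 p /\ ~ torsion F o 3 p.
Proof. exact: (pencil_base_point dimV hC1 hC3 hp hF smoothF flexo). Qed.
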